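(* Let $\mu$ be a nonzero finite Borel measure on $\mathbb{R}^d$ and let $(\vartheta_n)$ be a sequence in $\Theta$. If the sequence of probability measures $Q_{\vartheta_n}$ converges weakly to a Borel probability measure $P$ on $\mathbb{R}^d$, then one of the following two alternatives takes place: (i) The sequence $\vartheta_n$ converges to an element $\vartheta$ of $\Theta$, $P=Q_\vartheta$, and $Q_{\vartheta_n}\to P$ even in variation distance. (ii) $\|\vartheta_n\|\to\infty$, there exists a proper exposed face $G$ of $\operatorname{cs}(\mu)$ such that $P(G)=1$, and the limit of any convergent subsequence of $\vartheta_n/\|\vartheta_n\|$ exposes such a face (a proper face of $\operatorname{cs}(\mu)$ of $P$-probability $1$) of $\operatorname{cs}(\mu)$.
   Context: The convex support $\operatorname{cs}(\mu)$ is the intersection of all closed convex subsets $C$ of $\mathbb{R}^d$ with $\mu(C)=\mu(\mathbb{R}^d)$. For $B\subseteq\mathbb{R}^d$ nonempty, $\operatorname{lin}(B)$ is the linear subspace obtained by shifting the affine hull $\operatorname{aff}(B)$ to contain the origin; $\operatorname{lin}(\mu)=\operatorname{lin}(\operatorname{cs}(\mu))$. Put $\Lambda(\vartheta)=\ln\int_{\mathbb{R}^d}e^{\langle\vartheta,x\rangle}\mu(dx)\in(-\infty,+\infty]$, $\operatorname{dom}(\Lambda)=\{\vartheta\in\mathbb{R}^d:\Lambda(\vartheta)<\infty\}$, $\Theta=\operatorname{dom}(\Lambda)\cap\operatorname{lin}(\mu)$. For $\vartheta\in\operatorname{dom}(\Lambda)$, $Q_\vartheta$ is the probability measure with $\mu$-density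 $x\mapsto e^{\langle\vartheta,x\rangle-\Lambda(\vartheta)}$. A face of a nonempty convex set $C$ is a nonempty convex subset $F\subseteq C$ such that $tx+(1-t)y\in F$ with $x,y\in C$, $0<t<1$ implies $x,y\in F$; it is proper if $F\neq C$. A proper face $F$ of $C$ is exposed if $F=C\cap\{x:\langle\tau,x-a\rangle=0\}$ for some $a\in C$ and some unit vector $\tau\in\operatorname{lin}(C)$ such that $\langle\tau,x-a\rangle\le 0$ for all $x\in C$; such a $\tau$ is said to expose $F$ in $C$. Convergence in variation distance means that the total variation $|Q_{\vartheta_n}-P|$ goes to zero. *)

(* Defs.v *)
From HB Require Import structures.
From mathcomp Require Import all_boot all_order all_algebra.
From mathcomp Require Import all_classical all_reals all_analysis.
From mathcomp Require Import measurable_realfun.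

Set Implicit Arguments.
Unset Strict Implicit.
Unset Printing Implicit Defensive.

Import Order.TTheory GRing.Theory Num.Theory.
Import numFieldNormedType.Exports.

Local Open Scope classical_set_scope.
Local Open Scope ring_scope.

(* The matrix type ['rV[R]_d] carries the topology of R^d but no sigma-algebra;
   [borel R d] is the same type equipped with its Borel sigma-algebra. *)
Notation borel R d := (g_sigma_algebraType (@open 'rV[R]_d)).

Section euclidean.
Context {R : realType} {d : nat}.
Implicit Types (u v : 'rV[R]_d) (B : set 'rV[R]_d).

Definition dotv u v : R := \sum_(i < d) u ord0 i * v ord0 i.

(* The library norm [`|u|] on ['rV[R]_d] is the sup norm; both norms induce the
   same topology. *)
Definition enorm u : R := Num.sqrt (dotv u u).

Definition aff B : set 'rV[R]_d := [set y | exists n : nat,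
  exists x : 'I_n -> 'rV[R]_d, exists c : 'I_n -> R,
  [/\ (forall i, B (x i)), \sum_(i < n) c i = 1 &
      y = \sum_(i < n) c i *: x i]].

(* For B nonempty, aff B - a is the same linear subspace for every a in aff B. *)
Definition lin B : set 'rV[R]_d :=
  [set v | exists a y, [/\ aff B a, aff B y & v = y - a]].

End euclidean.

Section faces.
Context {R : realType} {d : nat}.
Implicit Types (C F : set 'rV[R]_d) (tau : 'rV[R]_d).

Definition face C F := [/\ F !=set0, convex_set F, F `<=` C &
  forall x y (t : R), C x -> C y -> 0 < t -> t < 1 ->
    F (t *: x + (1 - t) *: y) -> F x /\ F y].

Definition proper_face C F := face C F /\ F <> C.

Definition exposes tau C F := [/\ proper_face C F, enorm tau = 1, lin C tau &
  exists a, [/\ C a, (forall x, C x -> dotv tau (x - a) <= 0) &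
    F = C `&` [set x | dotv tau (x - a) = 0]]].

Definition exposed_face C F := exists tau, exposes tau C F.

End faces.

Section exponential_family.
Context {R : realType} {d : nat}.
Variable mu : {finite_measure set (borel R d) -> \bar R}.
Implicit Types theta : 'rV[R]_d.

Definition cs : set 'rV[R]_d :=
  \bigcap_(C in [set C : set 'rV[R]_d |
    [/\ closed C, convex_set C & mu C = mu setT]]) C.

Definition Lambda theta : \bar R :=
  lne (\int[mu]_x (expR (dotv theta x))%:E)%E.

Definition domLambda : set 'rV[R]_d := [set theta | (Lambda theta < +oo)%E].

Definition Theta : set 'rV[R]_d := domLambda `&` lin cs.

(* Outside domLambda the density is expeR (-oo) = 0, so that [Q theta] is a
   finite measure for every theta; it is a probability on domLambda when
   mu <> 0, see [Q_setT]. *)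
Definition Q theta (A : set (borel R d)) : \bar R :=
  (\int[mu]_(x in A) expeR ((dotv theta x)%:E - Lambda theta))%E.

Lemma continuous_dotv theta : continuous (dotv theta).
Proof.
have -> : dotv theta =
    \sum_(i < d) (fun v : 'rV[R]_d => theta ord0 i * v ord0 i).
  by apply/funext => v; rewrite fct_sumE.
elim/big_ind : _ => [x|f g cf cg x|i _ x]; first exact: cst_continuous.
- exact: (cvgD (cf x) (cg x)).
- apply: (@cvgMl_tmp R _ (nbhs x) _ (fun v : 'rV[R]_d => v ord0 i)).
  exact: coord_continuous.
Qed.

Lemma continuous_measurable_borel (f : 'rV[R]_d -> R) :
  continuous f -> measurable_fun [set: borel R d] f.
Proof.
move=> /continuousP cf.
apply: (measurability _ (RGenOpens.measurableE R)).
move=> _ [_ [a [b ->]] <-]; rewrite setTI; apply: sub_sigma_algebra.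
by apply: cf; exact: interval_open.
Qed.

Lemma measurable_expR_dotv theta :
  measurable_fun [set: borel R d] (fun x => (expR (dotv theta x))%:E).
Proof.
apply/measurable_EFinP; apply: measurableT_comp => //.
by apply: continuous_measurable_borel; exact: continuous_dotv.
Qed.

Lemma measurable_density theta : measurable_fun [set: borel R d]
  (fun x => expeR ((dotv theta x)%:E - Lambda theta)%E).
Proof.
case: (Lambda theta) => [r| |] /=; [|exact: measurable_cst..].
apply/measurable_EFinP; apply: measurableT_comp => //.
apply: measurable_funB => //.
by apply: continuous_measurable_borel; exact: continuous_dotv.
Qed.

Lemma LambdaNy_mu0 theta : Lambda theta = -oo%E -> mu setT = 0%E.
Proof.
move=> L.
have I0 : (\int[mu]_x (expR (dotv theta x))%:E = 0)%E.
  apply/eqP; rewrite eq_le integral_ge0 ?andbT; last first.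
    by move=> x _; rewrite lee_fin expR_ge0.
  move: L; rewrite /Lambda; case: (integral _ _ _) => //= s.
  by case: ifPn => //; rewrite lee_fin.
have : (\int[mu]_x `|(expR (dotv theta x))%:E| = 0)%E.
  rewrite -I0; apply: eq_integral => x _.
  by rewrite gee0_abs// lee_fin expR_ge0.
move/(ae_eq_integral_abs mu measurableT (measurable_expR_dotv theta)) => ae0.
apply: (negligibleP mu measurableT).1.
move: ae0; rewrite /ae_eq /almost_everywhere; apply: negligibleS.
move=> x _ /= /(_ I)[] /eqP.
by rewrite gt_eqF ?expR_gt0.
Qed.

Lemma Q_fin theta r : Lambda theta = r%:E -> Q theta setT = 1%E.
Proof.
move=> Lr; rewrite /Q Lr.
under eq_integral do rewrite expeRD muleC.
rewrite ge0_integralZl//=; last exact: measurable_expR_dotv.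
have -> : (\int[mu]_x (expR (dotv theta x))%:E = expeR r%:E)%E.
  rewrite -Lr /Lambda lneK// in_itv/= leey andbT.
  by apply: integral_ge0 => x _; rewrite lee_fin expR_ge0.
by rewrite /= -EFinM -expRD addNr expR0.
Qed.

Lemma Q_setT theta : mu setT != 0%E -> domLambda theta -> Q theta setT = 1%E.
Proof.
rewrite /domLambda/= => mu0; case L: (Lambda theta) => [r| |]// _.
  exact: Q_fin L.
by rewrite (LambdaNy_mu0 L) eqxx in mu0.
Qed.

Lemma Q_le1 theta : (Q theta setT <= 1)%E.
Proof.
case L: (Lambda theta) => [r| |]; first by rewrite (Q_fin L).
- by rewrite /Q L integral0_eq.
- rewrite /Q null_set_integral//; last exact: LambdaNy_mu0 L.
  exact: measurable_density.
Qed.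

Let Q0 theta : Q theta set0 = 0%E. Proof. exact: integral_set0. Qed.

Let Q_ge0 theta A : (0 <= Q theta A)%E.
Proof. by apply: integral_ge0 => x _; exact: expeR_ge0. Qed.

Let Q_sigma_additive theta : semi_sigma_additive (Q theta).
Proof.
apply: semi_sigma_additive_nng_induced; first exact: measurable_density.
by move=> x; exact: expeR_ge0.
Qed.

HB.instance Definition _ theta := isMeasure.Build _ _ _ (Q theta)
  (Q0 theta) (Q_ge0 theta) (@Q_sigma_additive theta).

Let Q_fin_num theta : fin_num_fun (Q theta).
Proof.
move=> A mA; rewrite ge0_fin_numE//.
apply: (@le_lt_trans _ _ 1%E); last exact: ltry.
apply: le_trans (Q_le1 theta).
by apply: le_measure; rewrite ?inE.
Qed.

HB.instance Definition _ theta :=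
  @Measure_isFinite.Build _ _ _ (Q theta) (@Q_fin_num theta).

End exponential_family.

Definition cvg_weakly {R : realType} {d : nat}
    (P_ : nat -> {finite_measure set (borel R d) -> \bar R})
    (P : {finite_measure set (borel R d) -> \bar R}) :=
  forall f : 'rV[R]_d -> R, continuous f -> bounded_fun f ->
    (\int[P_ n]_x (f x)%:E)%E @[n --> \oo] --> (\int[P]_x (f x)%:E)%E.

(* Total mass |nu|(T) of the variation of a signed measure; it does not depend
   on the chosen Hahn decomposition. *)
Definition variation_norm {dp} {T : measurableType dp} {R : realType}
    (nu : {charge set T -> \bar R}) : \bar R :=
  charge_variation (svalP (cid (svalP (cid (Hahn_decomposition nu))))) setT.

Definition variation_dist {dp} {T : measurableType dp} {R : realType}
    (P1 P2 : {finite_measure set T -> \bar R}) : \bar R :=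
  variation_norm (cadd (charge_of_finite_measure P1)
                       (copp (charge_of_finite_measure P2))).

(* Main.v *)
(* Write Z(theta) for the integral of exp <theta, x> against mu.  Along a
   convergent subsequence of theta_n, testing Q_(theta_n) -> P against cutoff
   functions shows that Z(theta_n) converges; Fatou's lemma and P(R^d) = 1
   identify the limit as Z(theta), so the densities converge pointwise and
   Scheffe's lemma gives convergence in variation.  Along a subsequence with
   |theta_n| -> oo and theta_n / |theta_n| -> tau, let s be the mu-essential
   supremum of <tau, x>: Q_(theta_n) gives exponentially small mass to bounded
   parts of any half-space <tau, x> < a with a < s, so P lives on <tau, x> = s,
   which cuts a proper face out of cs(mu).  The two behaviours exclude each other
   because Q_theta does not live on a proper face, and the limit theta is unique
   because theta |-> Q_theta is injective on Theta. *)
Require Import Defs.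
From HB Require Import structures.
From mathcomp Require Import all_boot all_order all_algebra.
From mathcomp Require Import all_classical all_reals all_analysis.
From mathcomp Require Import measurable_realfun.
From mathcomp Require Import ring.
Import Order.TTheory GRing.Theory Num.Theory.
Import numFieldNormedType.Exports.
Local Open Scope classical_set_scope.
Local Open Scope ring_scope.

(** Weak convergence sees only bounded continuous functions, and neither the exponentials nor the
    indicators of half-spaces are of that kind; hence the truncations to bounded sets. For divergent
    parameters the estimate itself forces them: replacing theta_n / |theta_n| by tau in the exponent
    costs |theta_n| times a small quantity times |x|, which is negligible against |theta_n| only for
    bounded x. The condition theta_n in lin(cs(mu)) acts through closedness of subspaces: the limits
    theta and tau stay in lin(cs(mu)). A vector of this space whose inner product is constant on
    cs(mu) is orthogonal to itself, hence zero; both the injectivity of theta |-> Q_theta and the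
    properness of the face come from this. That P has mass 1 serves three times: no mass is lost
    when the limit of Z(theta_n) is identified, the essential supremum s is finite, and the contact
    set of cs(mu) with <tau, x> = s is nonempty. *)

Section subsequences.

Lemma increasing_seq_oo (s : nat -> nat) : increasing_seq s -> s k @[k --> \oo] --> \oo.
Proof.
move=> sincr A [N _ NA]; exists N => // k /= Nk; apply: NA => /=.
apply: (leq_trans Nk); elim: k {Nk} => // k /leq_ltn_trans; apply.
by rewrite ltnNge; apply/negP => H; have := sincr k.+1 k; rewrite leEnat H ltnn.
Qed.

Lemma frequently_subseq (A : set nat) : (forall N, exists2 n, (N <= n)%N & A n) ->
  exists s : nat -> nat, increasing_seq s /\ forall k, A (s k).
Proof.
move=> HA; have Aoo : infinite_set A.
  move=> /finite_seqP[t At].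
  have [n + An] := HA (\max_(i <- t) i).+1.
  have : A n by [].
  by rewrite At => /= nt; apply/negP; rewrite -leqNgt; exact: leq_bigmax_seq.
have /= [|s [sincr _ As]] := infinite_increasing_seq_wf _ Aoo 0%N.
  by move=> n; apply: sub_finite_set (finite_II n.+1) => m /=.
by exists s.
Qed.

Lemma not_cvg_subseq {R : realType} {V : normedModType R} (u_ : nat -> V) (l : V) :
  ~ (u_ n @[n --> \oo] --> l) ->
  exists (e : R) (s : nat -> nat), [/\ 0 < e, increasing_seq s & forall k, e <= `|l - u_ (s k)|].
Proof.
move=> H; have [e e0 He] : exists2 e, 0 < e & forall N, exists2 n, (N <= n)%N & e <= `|l - u_ n|.
  apply: contrapT => /forall2NP He; apply: H; apply/cvgrPdist_lt => e e0.
  have [//|/existsNP[N HN]] := He e.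
  exists N => // n /= Nn; rewrite ltNge; apply/negP => en.
  by apply: HN; exists n.
have [s [sincr us]] := frequently_subseq [set n | e <= `|l - u_ n|] He.
by exists e, s.
Qed.

End subsequences.

(** * Inner product, affine hulls and subspaces *)

Section euclidean.
Context {R : realType} {d : nat}.
Implicit Types (u v w : 'rV[R]_d) (a : R).

Lemma dotvC u v : dotv u v = dotv v u.
Proof. by apply: eq_bigr => i _; rewrite mulrC. Qed.

Lemma dotvDr u v w : dotv u (v + w) = dotv u v + dotv u w.
Proof. by rewrite -big_split/=; apply: eq_bigr => i _; rewrite mxE mulrDr. Qed.

Lemma dotvZr u a v : dotv u (a *: v) = a * dotv u v.
Proof. by rewrite mulr_sumr; apply: eq_bigr => i _; rewrite mxE mulrCA. Qed.

Lemma dotvZl a u v : dotv (a *: u) v = a * dotv u v.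
Proof. by rewrite dotvC dotvZr (dotvC v). Qed.

Lemma dotvBr u v w : dotv u (v - w) = dotv u v - dotv u w.
Proof. by rewrite dotvDr -scaleN1r dotvZr mulN1r. Qed.

Lemma dotvBl u v w : dotv (u - v) w = dotv u w - dotv v w.
Proof. by rewrite dotvC dotvBr !(dotvC w). Qed.

Lemma dotv0r u : dotv u 0 = 0.
Proof. by rewrite /dotv big1// => i _; rewrite mxE mulr0. Qed.

Lemma dotv_sumr u n (F : 'I_n -> 'rV[R]_d) :
  dotv u (\sum_(i < n) F i) = \sum_(i < n) dotv u (F i).
Proof. by elim/big_ind2: _ => [|? ? ? ? <- <-|//]; [exact: dotv0r|rewrite dotvDr]. Qed.

Lemma dotvv_ge0 u : 0 <= dotv u u.
Proof. by apply: sumr_ge0 => i _; exact: sqr_ge0. Qed.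

Lemma dotvv_eq0 u : dotv u u = 0 -> u = 0.
Proof.
move=> /eqP; rewrite psumr_eq0 => [/allP u0|i _]; last exact: sqr_ge0.
apply/rowP => i; rewrite mxE; apply/eqP; rewrite -sqrf_eq0 expr2.
by apply: u0; rewrite mem_index_enum.
Qed.

Lemma enorm_ge0 u : 0 <= enorm u.
Proof. exact: sqrtr_ge0. Qed.

Lemma enormZ a u : enorm (a *: u) = `|a| * enorm u.
Proof.
rewrite /enorm dotvZl dotvZr mulrA sqrtrM; last exact: sqr_ge0.
by rewrite -expr2 sqrtr_sqr.
Qed.

Lemma coord_le_enorm u i : `|u ord0 i| <= enorm u.
Proof.
rewrite -sqrtr_sqr ler_sqrt ?dotvv_ge0// /dotv (bigD1 i)//= expr2 lerDl.
by apply: sumr_ge0 => j _; exact: sqr_ge0.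
Qed.

Lemma coord_le_norm u i : `|u ord0 i| <= `|u|.
Proof.
rewrite (_ : `|u| = mx_norm u)// mx_normrE.
by apply/bigmax_geP; right => /=; exists (ord0, i).
Qed.

Lemma norm_le_coord u K : 0 <= K -> (forall i, `|u ord0 i| <= K) -> `|u| <= K.
Proof.
move=> K0 uK; rewrite (_ : `|u| = mx_norm u)// mx_normrE; apply/bigmax_leP; split => //=.
by move=> [i j] _ /=; rewrite ord1.
Qed.

Lemma norm_le_enorm u : `|u| <= enorm u.
Proof. by apply: norm_le_coord => [|i]; [exact: enorm_ge0|exact: coord_le_enorm]. Qed.

Lemma dotv_le_norm u v : `|dotv u v| <= d%:R * `|u| * `|v|.
Proof.
rewrite (le_trans (ler_norm_sum _ _ _))//.
rewrite (@le_trans _ _ (\sum_(i < d) `|u| * `|v|))//.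
  by apply: ler_sum => i _; rewrite normrM ler_pM// coord_le_norm.
by rewrite sumr_const card_ord -[leLHS]mulr_natl mulrA.
Qed.

Lemma continuous_enorm : continuous (@enorm R d).
Proof.
move=> u; apply: (@continuous_comp _ _ _ (fun v => dotv v v) Num.sqrt); last exact: sqrt_continuous.
rewrite (_ : (fun v => dotv v v) =
    \sum_(i < d) (fun v : 'rV[R]_d => v ord0 i * v ord0 i)); last first.
  by apply/funext => v; rewrite fct_sumE.
elim/big_ind : _ => [|f g cf cg|i _]; first exact: cst_continuous.
- exact: (cvgD cf cg).
- have ci : (fun v : 'rV[R]_d => v ord0 i) v @[v --> u] --> (u ord0 i : R).
    exact: coord_continuous.
  exact: (cvgM ci ci).
Qed.

(** If the norms do not tend to infinity, some ball contains infinitely many terms, and compactness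
    applies there. The dichotomy is used for the whole parameter sequence, for its subsequences and
    for the normalized parameters. *)
Lemma bolzano_weierstrass_rV (u_ : nat -> 'rV[R]_d) :
  enorm (u_ n) @[n --> \oo] --> +oo \/
  exists (s : nat -> nat) (l : 'rV[R]_d), increasing_seq s /\ u_ (s k) @[k --> \oo] --> l.
Proof.
have [?|noo] := pselect (enorm (u_ n) @[n --> \oo] --> +oo); [by left|right].
have [K [K0 HK]] : exists K : R, 0 < K /\ forall N, exists2 n, (N <= n)%N & enorm (u_ n) < K.
  apply: contrapT => H; apply: noo; apply/cvgryPgt => A.
  move/forallNP : H => /(_ (`|A| + 1)) /not_andP[|/existsNP[N HN]].
    by rewrite ltr_wpDl.
  exists N => // n /= Nn; rewrite ltNge; apply/negP => unA.
  by apply: HN; exists n => //; rewrite (le_lt_trans unA)// (le_lt_trans (ler_norm A))// ltrDl.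
have [s [sincr us]] := frequently_subseq [set n | enorm (u_ n) < K] HK.
pose C := [set v : 'rV[R]_d | `|v| <= K].
have cC : compact C.
  apply: bounded_closed_compact.
    exists K; split => [|M KM v]; [exact: num_real|move=> /= /le_trans; apply; exact: ltW].
  apply: (closed_comp _ (@closed_le _ K)) => v _; exact: norm_continuous.
have [l [_ cl]] : C `&` cluster ((u_ \o s) @ \oo) !=set0.
  apply: cC; exists 0%N => // n _ /=.
  by apply: (le_trans (norm_le_enorm _)); exact/ltW/us.
(* The cluster point [l] becomes a limit along a subsequence through the scalar distances to [l],
   which cluster at 0. *)
have : cluster ((fun n => `|l - u_ (s n)|) @ \oo) 0.
  apply/cluster_eventuallyP => e n e0.
  have [v [[m /= nm <-] ev]] := cl [set u_ (s m) | m in [set m | (n <= m)%N]] (ball l e)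
    ltac:(by exists n => // m nm /=; exists m) (nbhsx_ballx l _ e0).
  exists m => //; rewrite sub0r normrN normr_id.
  by move: ev; rewrite -ball_normE /= => /ltW.
move=> /cluster_eventually_cvg[r rincr rl].
exists (s \o r), l; split; first by move=> i j /=; rewrite sincr; exact: rincr.
apply/cvgrPdist_lt => e e0; move/cvgrPdist_lt : rl => /(_ _ e0).
by apply: filterS => n /=; rewrite sub0r normrN normr_id.
Qed.

Definition subspace (L : set 'rV[R]_d) :=
  [/\ L 0, (forall u v, L u -> L v -> L (u + v)) & forall a u, L u -> L (a *: u)].

(* A matrix of maximal rank among those with all rows in [L] has row space [L],
   which is then the zero set of a linear map. *)
Lemma closed_subspace (L : set 'rV[R]_d) : subspace L -> closed L.
Proof.
move=> [L0 LD LZ].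
have Lsum n (F : 'I_n -> 'rV[R]_d) : (forall i, L (F i)) -> L (\sum_(i < n) F i).
  by move=> LF; elim/big_ind: _.
have Lsub m (M : 'M[R]_(m, d)) v : (forall i, L (row i M)) -> (v <= M)%MS -> L v.
  move=> LM /submxP[D ->]; rewrite mulmx_sum_row; apply: Lsum => i; exact: LZ.
pose p n := `[< exists M : 'M[R]_d, (forall i, L (row i M)) /\ \rank M = n >].
have p0 : exists n, p n.
  exists 0%N; apply/asboolP; exists 0; split; last exact: mxrank0.
  by move=> i; rewrite row0.
have pd n : p n -> (n <= d)%N by move=> /asboolP[M [_ <-]]; exact: rank_leq_row.
case: (ex_maxnP p0 pd) => n /asboolP[M [LM rM]] maxn.
have LE : L = [set v | (v <= M)%MS].
  apply/seteqP; split => v /=; last exact: Lsub.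
  move=> Lv; apply: contrapT => /negP vM.
  have pc : p (\rank (M + v)%MS).
    apply/asboolP; exists (M + v)%MS; split=> // i.
    apply: (@Lsub _ (col_mx M v)); last by rewrite -addsmxE row_sub.
    move=> j; rewrite -(fintype.splitK j); case: (fintype.split j) => k /=.
      by rewrite rowKu.
    by rewrite rowKd (_ : row k v = v)//; apply/rowP => l; rewrite mxE ord1.
  have := maxn _ pc; rewrite -rM leqNgt => /negP; apply.
  have : (M < M + v)%MS by rewrite ltmxE addsmxSl addsmx_sub submx_refl.
  by rewrite ltmxErank => /andP[].
rewrite LE (_ : mkset _ = \bigcap_(j in [set: 'I_d])
    [set v | dotv (col j (cokermx M))^T v = 0]).
  apply: closed_bigI => j _.
  by apply: (closed_comp _ (@closed_eq _ (0:R))) => v _; exact: continuous_dotv.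
have E v j : dotv (col j (cokermx M))^T v = (v *m cokermx M) ord0 j.
  by rewrite mxE /dotv; apply: eq_bigr => k _; rewrite !mxE mulrC.
apply/seteqP; split => v /=.
  by rewrite submxE => /eqP v0 j _; rewrite /= E v0 mxE.
by move=> v0; rewrite submxE; apply/eqP/rowP => j; rewrite -E v0// mxE.
Qed.

Lemma combination_add (B : set 'rV[R]_d) m n (x : 'I_m -> 'rV[R]_d) (c : 'I_m -> R)
    (y : 'I_n -> 'rV[R]_d) (e : 'I_n -> R) :
  (forall i, B (x i)) -> (forall i, B (y i)) ->
  exists (z : 'I_(m + n) -> 'rV[R]_d) (f : 'I_(m + n) -> R),
    [/\ forall i, B (z i), \sum_(i < m + n) f i = \sum_(i < m) c i + \sum_(i < n) e i &
        \sum_(i < m + n) f i *: z i = \sum_(i < m) c i *: x i + \sum_(i < n) e i *: y i].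
Proof.
move=> Bx By.
exists (fun i => match fintype.split i with inl j => x j | inr j => y j end),
  (fun i => match fintype.split i with inl j => c j | inr j => e j end).
have El i : fintype.split (lshift n i) = inl i := unsplitK (inl i).
have Er i : fintype.split (rshift m i) = inr i := unsplitK (inr i).
split; first by move=> i; case: (fintype.split i).
  by rewrite big_split_ord/=; congr (_ + _); apply: eq_bigr => i _; rewrite ?El ?Er.
by rewrite big_split_ord/=; congr (_ + _); apply: eq_bigr => i _; rewrite ?El ?Er.
Qed.

(** Weights of total 0 remove the base point from the definition, so that closure under linear
    operations and orthogonality to [lin B] become computations with finite sums. *)
Lemma linP (B : set 'rV[R]_d) v : B !=set0 -> lin B v <->
  exists n (x : 'I_n -> 'rV[R]_d) (c : 'I_n -> R),
    [/\ forall i, B (x i), \sum_(i < n) c i = 0 & v = \sum_(i < n) c i *: x i].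
Proof.
move=> [b Bb]; split.
  move=> [_ [_ [[n [x [c [Bx c1 ->]]]] [m [y [e [By e1 ->]]]] ->]]].
  have [z [f [Bz fE zE]]] := @combination_add B _ _ y e x (fun i => - c i) By Bx.
  exists (m + n)%N, z, f; split => //; first by rewrite fE sumrN e1 c1 subrr.
  by rewrite zE -sumrN; congr (_ + _); apply: eq_bigr => i _; rewrite scaleNr.
move=> [n [x [c [Bx c0 ->]]]]; exists b, (b + \sum_(i < n) c i *: x i); split.
- exists 1%N, (fun=> b), (fun=> 1); split => //; rewrite big_ord1//.
  by rewrite scale1r.
- have [z [f [Bz fE zE]]] := @combination_add B 1 _ (fun=> b) (fun=> 1) x c (fun=> Bb) Bx.
  exists (1 + n)%N, z, f; split => //; first by rewrite fE c0 addr0 big_ord1.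
  by rewrite zE big_ord1 scale1r.
- by rewrite addrAC subrr add0r.
Qed.

Lemma subspace_lin (B : set 'rV[R]_d) : B !=set0 -> subspace (lin B).
Proof.
move=> B0; split.
- apply/linP => //; exists 0%N, (fun=> 0), (fun=> 0); split; [by case|by rewrite big_ord0..].
- move=> u v /(linP _ _ B0)[n [x [c [Bx c0 ->]]]] /(linP _ _ B0)[m [y [e [By e0 ->]]]].
  apply/linP => //; have [z [f [Bz fE zE]]] := @combination_add B _ _ x c y e Bx By.
  by exists (n + m)%N, z, f; split => //; rewrite fE c0 e0 addr0.
- move=> a u /(linP _ _ B0)[n [x [c [Bx c0 ->]]]]; apply/linP => //.
  exists n, x, (fun i => a * c i); split => //.
    by rewrite -mulr_sumr c0 mulr0.
  by rewrite scaler_sumr; apply: eq_bigr => i _; rewrite scalerA.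
Qed.

(** Weights of total 0 annihilate constants. The applications take [v] equal to [u], which gives
    [dotv u u = 0]. *)
Lemma dotv_lin_eq0 (B : set 'rV[R]_d) u v k :
  (forall x, B x -> dotv u x = k) -> B !=set0 -> lin B v -> dotv u v = 0.
Proof.
move=> uk B0 /(linP _ _ B0)[n [x [c [Bx c0 ->]]]].
rewrite dotv_sumr (eq_bigr (fun i => c i * k)) => [|i _]; last by rewrite dotvZr uk.
by rewrite -mulr_suml c0 mul0r.
Qed.

End euclidean.

(** * Borel sets, weak convergence and densities *)

Section null_sets.
Context {dp} {T : measurableType dp} {R : realType}.

Lemma null_bigcup (m : {measure set T -> \bar R}) (A : set T) (F : nat -> set T) :
  measurable A -> (forall n, measurable (F n)) -> (forall n, m (F n) = 0%E) ->
  A `<=` \bigcup_n F n -> m A = 0%E.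
Proof.
move=> mA mF F0 AF; apply/(negligibleP m) => //.
apply: (negligibleS AF); apply: negligible_bigcup => n.
exact: (negligibleP m (mF n)).2 (F0 n).
Qed.

End null_sets.

Section borel_theory.
Context {R : realType} {d : nat}.

Lemma open_measurable_borel (U : set 'rV[R]_d) : open U -> measurable (U : set (borel R d)).
Proof. by move=> oU; apply: sub_sigma_algebra. Qed.

Lemma closed_measurable_borel (C : set 'rV[R]_d) : closed C -> measurable (C : set (borel R d)).
Proof.
move=> cC; rewrite -[C]setCK; apply: (@measurableC _ (borel R d)).
by apply: open_measurable_borel; exact: closed_openC.
Qed.

Lemma rational_ball (x : 'rV[R]_d) (e : R) : 0 < e ->
  exists (q : 'rV[rat]_d) (n : nat), ball (map_mx ratr q : 'rV[R]_d) n.+1%:R^-1 x /\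
    ball (map_mx ratr q : 'rV[R]_d) n.+1%:R^-1 `<=` ball x e.
Proof.
move=> e0; have [n ne] : exists n : nat, n.+1%:R^-1 < e / 2.
  have /ltr_add_invr[n] : 0 < e / 2 by rewrite divr_gt0.
  by rewrite add0r => ne; exists n.
have n0 : 0 < n.+1%:R^-1 :> R by rewrite invr_gt0.
have /choice[q qx] : forall i, exists q : rat, `|x ord0 i - ratr q| < n.+1%:R^-1.
  move=> i; have [|q] := @rat_in_itvoo R (x ord0 i - n.+1%:R^-1) (x ord0 i + n.+1%:R^-1).
    by rewrite ltrBlDr -addrA ltrDl addr_gt0.
  by rewrite in_itv/= -ltr_distlC => qx; exists q.
exists (\row_i q i), n.
have xq : ball (map_mx ratr (\row_i q i) : 'rV[R]_d) n.+1%:R^-1 x.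
  by split => // i j; rewrite !mxE ord1; apply: ball_sym; exact: qx.
split => // y qy; apply: (@le_ball _ _ _ (n.+1%:R^-1 + n.+1%:R^-1)).
  by rewrite [leRHS]splitr lerD// ltW.
by apply: ball_triangle qy; exact: ball_sym.
Qed.

(* Lindelof's theorem, applied to the balls with rational centers. *)
Lemma countable_ball_cover (U : set 'rV[R]_d) (P : set (set 'rV[R]_d)) : P set0 ->
  (forall x, U x -> exists2 e : R, 0 < e & forall A, A `<=` ball x e -> P A) ->
  exists F : nat -> set 'rV[R]_d, [/\
    forall n, F n = set0 \/ exists (c : 'rV[R]_d) (e : R), F n = ball c e,
    forall n, P (F n) & U `<=` \bigcup_n F n].
Proof.
move=> P0 PU.
pose B (q : 'rV[rat]_d * nat) : set 'rV[R]_d := ball (map_mx ratr q.1 : 'rV[R]_d) q.2.+1%:R^-1.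
(* Codes that name no ball, or a ball outside [P], go to [set0]; this is the reason for the
   hypothesis [P set0] and for the empty sets in the first conclusion. *)
pose F n := match unpickle n with
  | Some q => if pselect (P (B q)) then B q else set0
  | None => set0 end.
exists F; split.
- move=> n; rewrite /F; case: unpickle => [q|]; last by left.
  by case: pselect => Pq; [right; eexists; eexists; reflexivity|left].
- by move=> n; rewrite /F; case: unpickle => // q; case: pselect.
- move=> x /PU[e e0 PA]; have [q [n [qx qe]]] := rational_ball x e e0.
  exists (pickle (q, n)) => //; rewrite /F pickleK.
  by case: pselect => // -[]; exact: PA.
Qed.

End borel_theory.

(** * Bounded continuous test functions and uniqueness of weak limits *)

Section bump.
Context {R : realType} {d : nat}.
Implicit Types (f g : 'rV[R]_d -> R).

(** Composition with [clamp] makes any continuous function an admissible test function for weak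
    convergence and keeps the set where it is positive. *)
Definition clamp (t : R) : R := Num.max 0 (Num.min 1 t).

Lemma clamp_ge0 t : 0 <= clamp t.
Proof. by rewrite le_max lexx. Qed.

Lemma clamp_le1 t : clamp t <= 1.
Proof. by rewrite ge_max ler01 ge_min lexx. Qed.

Lemma clamp_gt0 t : (0 < clamp t) = (0 < t).
Proof. by rewrite lt_max ltxx/= lt_min ltr01. Qed.

Lemma clamp_eq0 t : t <= 0 -> clamp t = 0.
Proof. by move=> t0; apply/eqP; rewrite eq_le clamp_ge0 andbT leNgt clamp_gt0 -leNgt. Qed.

Lemma clamp_eq1 t : 1 <= t -> clamp t = 1.
Proof. by move=> t1; rewrite /clamp min_l// max_r. Qed.

Lemma continuous_clamp f : continuous f -> continuous (fun x => clamp (f x)).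
Proof.
move=> cf x; apply: (@continuous_max _ _ (cst 0) (fun x => Num.min 1 (f x))).
  exact: cst_continuous.
by apply: (@continuous_min _ _ (cst 1) f); [exact: cst_continuous|exact: cf].
Qed.

Lemma bounded_clamp f : bounded_fun (fun x => clamp (f x)).
Proof.
exists 1; split; first exact: num_real.
move=> M M1 x _ /=; rewrite ger0_norm ?clamp_ge0//.
by rewrite (le_trans (clamp_le1 _))// ltW.
Qed.

Lemma continuous_bounded_integrable (m : {finite_measure set (borel R d) -> \bar R}) f :
  continuous f -> bounded_fun f -> m.-integrable setT (EFin \o f).
Proof.
move=> cf bf; apply: measurable_bounded_integrable => //.
- by rewrite ltey_eq fin_num_measure.
- exact: continuous_measurable_borel.
Qed.

Lemma integral_eq0_pos (m : {measure set (borel R d) -> \bar R}) f :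
  continuous f -> (forall x, 0 <= f x) ->
  (\int[m]_x (f x)%:E = 0)%E -> m [set x | 0 < f x] = 0%E.
Proof.
move=> cf f0 If.
have mf : measurable_fun [set: borel R d] (EFin \o f).
  by apply/measurable_EFinP; exact: continuous_measurable_borel.
have : (\int[m]_x `|(f x)%:E| = 0)%E.
  by rewrite -If; apply: eq_integral => x _; rewrite gee0_abs ?lee_fin.
move/(ae_eq_integral_abs m measurableT mf) => ae0.
apply: (negligibleP m _).1.
  by apply: open_measurable_borel; apply: (open_comp _ (@open_gt _ 0)) => x _; exact: cf.
move: ae0; rewrite /ae_eq /almost_everywhere; apply: negligibleS.
by move=> x /= fx /(_ I)[] /eqP; rewrite gt_eqF.
Qed.

(** A case of the portmanteau inequality for open sets: the limit of the integrals is the integral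
    against [P], and a nonnegative function of zero integral is positive only on a null set. *)
Lemma cvg_weakly_null
    (P_ : nat -> {finite_measure set (borel R d) -> \bar R})
    (P : {finite_measure set (borel R d) -> \bar R}) f :
  cvg_weakly P_ P -> continuous f ->
  (\int[P_ n]_x (clamp (f x))%:E)%E @[n --> \oo] --> 0%E ->
  P [set x | 0 < f x] = 0%E.
Proof.
move=> PP cf If.
have cc := continuous_clamp _ cf.
have := PP _ cc (bounded_clamp f) => /(cvg_unique _ If) /esym/integral_eq0_pos.
move=> /(_ cc (fun=> clamp_ge0 _)).
have E : [set x | 0 < clamp (f x)] = [set x | 0 < f x].
  by apply/seteqP; split => x /=; rewrite clamp_gt0.
by rewrite E; apply; exact: ereal_hausdorff.
Qed.

(** The indicator of such a set is the increasing limit of the bounded continuous functions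
    [clamp (n%:R * f x)], so its measure can be read off from test functions. *)
Definition cozero (U : set 'rV[R]_d) :=
  exists2 f : 'rV[R]_d -> R, continuous f & U = [set x | 0 < f x].

Lemma setI_closed_cozero : setI_closed cozero.
Proof.
move=> _ _ [f cf ->] [g cg ->]; exists (fun x => Num.min (f x) (g x)).
  by move=> x; apply: (@continuous_min _ _ f g); [exact: cf|exact: cg].
by apply/seteqP; split => x /=; rewrite lt_min => /andP.
Qed.

Lemma cozero_ball (c : 'rV[R]_d) (e : R) : cozero (ball c e).
Proof.
exists (fun x => e - `|c - x|).
  move=> x; have cx : (fun y : 'rV[R]_d => c - y) y @[y --> x] --> c - x.
    apply: (@cvgB _ _ _ (nbhs x) _ (fun y : 'rV[R]_d => c)); last exact: cvg_id.
    exact: (@cst_continuous 'rV[R]_d 'rV[R]_d c x).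
  apply: (@cvgB R R^o _ (nbhs x) _ (fun=> e) (fun y : 'rV[R]_d => `|c - y|)).
    exact: (@cst_continuous 'rV[R]_d R e x).
  exact: cvg_norm.
by apply/funext => x; rewrite -ball_normE /= subr_gt0.
Qed.

(** Balls are cozero, and every open set is a countable union of balls. *)
Lemma borel_cozero : @measurable _ (borel R d) = <<s cozero >>.
Proof.
apply/seteqP; split.
  apply: smallest_sub; first exact: smallest_sigma_algebra.
  move=> U oU.
  have [] := @countable_ball_cover R d U [set A | A `<=` U].
  - exact: sub0set.
  - move=> x Ux; have : nbhs x U by exact: open_nbhs_nbhs.
    by move=> /nbhs_ballP[e e0 eU]; exists e => // A /subset_trans; exact.
  move=> F [FE FU UF].
  have -> : U = \bigcup_n F n.
    by apply/seteqP; split => // x [n _ /FU].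
  apply: (@bigcupT_measurable _ (g_sigma_algebraType cozero)) => n.
  have [->|[c [e ->]]] := FE n; first exact: (@measurable0 _ (g_sigma_algebraType cozero)).
  by apply: sub_sigma_algebra; exact: cozero_ball.
apply: smallest_sub; first exact: smallest_sigma_algebra.
move=> _ [f cf ->]; apply: open_measurable_borel.
by apply: (open_comp _ (@open_gt _ 0)) => x _; exact: cf.
Qed.

(** Cozero sets form a generating pi-system, so the measures need only be compared there, where
    dominated convergence recovers them from test functions. *)
Lemma eq_measure_continuous (m1 m2 : {finite_measure set (borel R d) -> \bar R}) :
  (forall f, continuous f -> bounded_fun f ->
    (\int[m1]_x (f x)%:E = \int[m2]_x (f x)%:E)%E) ->
  forall A : set (borel R d), measurable A -> m1 A = m2 A.
Proof.
move=> m12 A mA.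
apply: (@measure_unique _ R (borel R d) cozero (fun=> setT)) => //.
- exact: borel_cozero.
- exact: setI_closed_cozero.
- by move=> _; exists (cst 1); [exact: cst_continuous|apply/seteqP; split => x //= _; exact: ltr01].
- by rewrite bigcup_const//; exists 0%N.
- move=> _ [f cf ->].
  have mU : measurable ([set x | 0 < f x] : set (borel R d)).
    apply: open_measurable_borel.
    by apply: (open_comp _ (@open_gt _ 0)) => x _; exact: cf.
  have key (m : {finite_measure set (borel R d) -> \bar R}) :
      (\int[m]_x (clamp (n%:R * f x))%:E)%E @[n --> \oo] --> m [set x | 0 < f x].
    have cn n : continuous (fun x => n%:R * f x).
      by move=> x; apply: (@cvgMl_tmp R _ (nbhs x) _ f); exact: cf.
    rewrite -[X in _ --> m X]setIT -(integral_indic m measurableT) //.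
    apply: (@dominated_cvg _ (borel R d) R m setT measurableT _ _ (cst 1%E)) => //.
    + move=> n; apply/measurable_EFinP; apply: continuous_measurable_borel.
      exact/continuous_clamp.
    + move=> x _; apply: cvg_EFin; first exact: nearW.
      apply: cvg_near_cst; rewrite indicE; have [fx|fx] := ltP 0 (f x).
        (* From this index on, [n%:R * f x] is at least 1. *)
        rewrite mem_set//; exists (Num.truncn (f x)^-1).+1 => // n /= nf.
        rewrite clamp_eq1// -ler_pdivrMr// mul1r ltW//.
        by rewrite (lt_le_trans (truncnS_gt _))// ler_nat.
      rewrite memNset/=; last by move=> /= ; rewrite ltNge fx.
      by apply: nearW => n; rewrite clamp_eq0// mulr_ge0_le0.
    + exact: finite_measure_integrable_cst.
    + by move=> n x _; rewrite gee0_abs ?lee_fin ?clamp_ge0 ?clamp_le1.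
  have E : (fun n => \int[m1]_x (clamp (n%:R * f x))%:E)%E =
      (fun n => \int[m2]_x (clamp (n%:R * f x))%:E)%E.
    apply/funext => n; apply: m12 (bounded_clamp _).
    by apply: continuous_clamp => x; apply: (@cvgMl_tmp R _ (nbhs x) _ f); exact: cf.
  have := key m1; rewrite E => k1.
  exact: (cvg_unique (@ereal_hausdorff R) k1 (key m2)).
- move=> _; rewrite ltey_eq fin_num_measure//.
Qed.

End bump.

(** * The convex support *)

Section convex_support.
Context {R : realType} {d : nat} (mu : {finite_measure set (borel R d) -> \bar R}).

Lemma closed_cs : closed (cs mu).
Proof. by apply: closed_bigI => C []. Qed.

Lemma convex_cs : convex_set (cs mu).
Proof.
move=> x y l; rewrite !inE => xcs ycs C C_; case: (C_) => _ cC _.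
by have := cC x y l; rewrite !inE; apply; [exact: xcs|exact: ycs].
Qed.

Lemma convex_setP (A : set 'rV[R]_d) : convex_set A <->
  forall x y (t : R), A x -> A y -> 0 <= t -> t <= 1 -> A (t *: x + (1 - t) *: y).
Proof.
split=> [cA x y t Ax Ay t0 t1|cA x y l].
  by have := cA x y (Itv01 t0 t1); rewrite !inE; exact.
by rewrite !inE => Ax Ay; apply: cA.
Qed.

(** The complement is an uncountable union of null sets. By Lindelof it is covered by countably many
    balls, each inside the complement of a single closed convex set of full measure. *)
Lemma cs_measureC : mu (~` cs mu) = 0%E.
Proof.
have [] := @countable_ball_cover R d (~` cs mu)
  [set A | exists C, [/\ closed C, convex_set C, mu C = mu setT & A `<=` ~` C]].
- by exists setT; split=> [|x y l _ _|//|x []]; [exact: closedT|rewrite inE].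
- move=> x /= /existsNP[C /not_implyP[[cC vC mC] Cx]].
  have : nbhs x (~` C) by apply: open_nbhs_nbhs; split => //; exact: closed_openC.
  move=> /nbhs_ballP[e e0 eC]; exists e => // A /subset_trans Ae.
  by exists C; split => //; exact: Ae.
move=> F [_ PF UF].
apply/(negligibleP mu).
  by apply: open_measurable_borel; apply: closed_openC; exact: closed_cs.
apply: (@negligibleS _ (borel R d) R mu _ _ UF); apply: negligible_bigcup => n.
have [C [cC _ mC FC]] := PF n; apply: (@negligibleS _ (borel R d) R mu _ _ FC).
have mC' : measurable (C : set (borel R d)) by exact: closed_measurable_borel.
apply/(negligibleP mu); first exact: measurableC.
by rewrite -setTD measureD ?setTI//= ?mC ?subee ?fin_num_measure// ltey_eq fin_num_measure.
Qed.

(** Minimality in terms of null complements; it traps [cs mu] in half-spaces, in hyperplanes and in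
    closed faces. *)
Lemma cs_sub (C : set 'rV[R]_d) :
  closed C -> convex_set C -> mu (~` C) = 0%E -> cs mu `<=` C.
Proof.
move=> cC vC mC x; apply; split => //.
have mC' : measurable (C : set (borel R d)) by exact: closed_measurable_borel.
have : (mu (~` (C : set (borel R d)) `|` C) = mu (~` (C : set (borel R d))) + mu C)%E.
  by apply: measureU => //; [exact: measurableC|exact: setICl].
by rewrite setvU mC add0e => ->.
Qed.

Lemma cs_neq0 : mu setT != 0%E -> cs mu !=set0.
Proof.
move=> mu0; apply/set0P/negP => /eqP cs0.
by have := cs_measureC; rewrite cs0 setC0 => /eqP; rewrite (negbTE mu0).
Qed.

End convex_support.

(** * Densities and their convergence in L1 *)

Section density.
Context d (T : measurableType d) (R : realType).
Local Open Scope ereal_scope.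

(** Having the same integral over every measurable set, [q] and the Radon-Nikodym derivative agree
    almost everywhere, and the change of variables for the latter applies. *)
Lemma integral_density (nu : {finite_measure set T -> \bar R})
    (mu : {sigma_finite_measure set T -> \bar R}) (q f : T -> \bar R) :
  mu.-integrable setT q ->
  (forall A, measurable A -> nu A = \int[mu]_(x in A) q x) ->
  nu.-integrable setT f -> \int[nu]_x f x = \int[mu]_x (f x * q x).
Proof.
move=> iq nuq ifn.
have numu : nu `<< mu.
  apply/null_content_dominatesP => A mA muA; rewrite nuq// null_set_integral//.
  exact: measurable_funTS (measurable_int _ iq).
have mq := measurable_int _ iq; have mf := measurable_int _ ifn.
rewrite -(Radon_Nikodym_change_of_variables numu measurableT ifn).
apply: ae_eq_integral => //; [exact: emeasurable_funM..|].
apply: ae_eqe_mul2l; apply: integral_ae_eq => // [|E _ mE].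
  exact: Radon_Nikodym_integrable.
by rewrite -Radon_Nikodym_integral//= -nuq.
Qed.

(** The masses being equal, [|f_ n - f|] integrates to twice the positive part of [f - f_ n]. This
    part is dominated by [f], although the [f_ n] have no common dominating function. *)
Lemma scheffe (mu : {measure set T -> \bar R}) (f_ : nat -> T -> R) (f : T -> R) :
  (forall n, measurable_fun setT (f_ n)) -> measurable_fun setT f ->
  (forall n x, 0 <= f_ n x)%R -> (forall x, 0 <= f x)%R ->
  (forall n, \int[mu]_x (f_ n x)%:E = 1) -> \int[mu]_x (f x)%:E = 1 ->
  (forall x, f_ n x @[n --> \oo] --> f x)%R ->
  \int[mu]_x `|f_ n x - f x|%:E @[n --> \oo] --> 0.
Proof.
move=> mf_ mf f_0 f0 If_ If f_f.
have mh n : measurable_fun setT (fun x => (Num.max 0 (f x - f_ n x))%R).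
  by apply: measurable_maxr => //; exact: measurable_funB.
have intf : mu.-integrable setT (EFin \o f).
  apply/integrableP; split; first exact/measurable_EFinP.
  rewrite (eq_integral (EFin \o f)) ?If ?ltry// => x _.
  by rewrite gee0_abs ?lee_fin.
have h0 : \int[mu]_x (Num.max 0 (f x - f_ n x))%:E @[n --> \oo] --> 0.
  rewrite -[X in _ --> X](@integral0 _ _ _ mu setT).
  apply: (@dominated_cvg _ T R mu setT measurableT _ _ (EFin \o f)) => //.
  - by move=> n; exact/measurable_EFinP.
  - move=> x _; apply: cvg_EFin; first exact: nearW.
    apply/cvgrPdist_lt => e e0; move/cvgrPdist_lt : (f_f x) => /(_ _ e0).
    apply: filterS => n; rewrite sub0r normrN => fe.
    by rewrite /=; have [_|_] := leP (f x - f_ n x)%R 0%R; rewrite ?normr0.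
  - move=> n x _; rewrite gee0_abs ?lee_fin ?le_max ?lexx//.
    by rewrite ge_max f0/= gerBl f_0.
have E n : \int[mu]_x `|f_ n x - f x|%:E = 2%:E * \int[mu]_x (Num.max 0 (f x - f_ n x))%:E.
  (* The pointwise identity [|a - b| + b = 2 * max 0 (b - a) + a] has only nonnegative terms, so it
     integrates without subtracting extended reals. *)
  have : \int[mu]_x `|f_ n x - f x|%:E + \int[mu]_x (f x)%:E =
    2%:E * \int[mu]_x (Num.max 0 (f x - f_ n x))%:E + \int[mu]_x (f_ n x)%:E.
    have m1 : measurable_fun setT (fun x => (Num.max 0 (f x - f_ n x))%:E).
      exact/measurable_EFinP.
    have m2 : measurable_fun setT (fun x => 2%:E * (Num.max 0 (f x - f_ n x))%:E).
      exact: measurable_funeM.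
    have m3 : measurable_fun setT (fun x => (f_ n x)%:E) by exact/measurable_EFinP.
    have m4 : measurable_fun setT (fun x => (f x)%:E) by exact/measurable_EFinP.
    have m5 : measurable_fun setT (fun x => `|f_ n x - f x|%:E).
      by apply/measurable_EFinP; apply: measurableT_comp => //; exact: measurable_funB.
    have p1 x : (0 <= Num.max 0 (f x - f_ n x))%R by rewrite le_max lexx.
    have p2 x : setT x -> 0 <= 2%:E * (Num.max 0 (f x - f_ n x))%:E.
      by move=> _; rewrite -EFinM lee_fin mulr_ge0.
    rewrite -ge0_integralZl//; last by move=> x _; rewrite lee_fin.
    rewrite -ge0_integralD// -?ge0_integralD//; [|by move=> x _; rewrite lee_fin..].
    apply: eq_integral => x _; rewrite -EFinM -!EFinD; congr EFin.
    have [fx|fx] := leP (f x - f_ n x)%R 0%R.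
      rewrite subr_le0 in fx.
      by rewrite ger0_norm ?subr_ge0// mulr0 add0r subrK.
    rewrite subr_gt0 in fx.
    rewrite ltr0_norm ?subr_lt0// opprB.
    by rewrite mulr_natl mulr2n -[RHS]addrA subrK.
  by rewrite If If_ => /(congr1 (fun y => y - 1)); rewrite !addeK.
rewrite (_ : (fun n => _) = (fun n => 2%:E * \int[mu]_x (Num.max 0 (f x - f_ n x))%:E)); last first.
  exact/funext.
have : 2%:E * \int[mu]_x (Num.max 0 (f x - f_ n x))%:E @[n --> \oo] --> 2%:E * (0 : \bar R).
  exact: cvgeZl.
by rewrite mule0.
Qed.

Lemma abse_integral_sub_le (mu : {measure set T -> \bar R}) (f q1 q2 : T -> R) (M : R) :
  measurable_fun setT f -> (forall x, `|f x| <= M)%R ->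
  mu.-integrable setT (EFin \o q1) -> mu.-integrable setT (EFin \o q2) ->
  `|\int[mu]_x (f x * q1 x)%:E - \int[mu]_x (f x * q2 x)%:E| <=
    M%:E * \int[mu]_x `|q1 x - q2 x|%:E.
Proof.
move=> mf fM i1 i2.
have m1 : measurable_fun setT q1 by apply/measurable_EFinP; exact: measurable_int i1.
have m2 : measurable_fun setT q2 by apply/measurable_EFinP; exact: measurable_int i2.
(* A negative bound [M] forces the space to be empty. *)
have [M0|M0] := ltP M 0%R.
  rewrite (_ : setT = set0 :> set T); first by rewrite !integral_set0 subee// abse0 mule0.
  rewrite -subset0 => x _.
  by have := le_lt_trans (fM x) M0; rewrite ltNge normr_ge0.
have ifq (q : T -> R) : mu.-integrable setT (EFin \o q) ->
    mu.-integrable setT (fun x => (f x * q x)%:E).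
  move=> iq; have mq : measurable_fun setT q by apply/measurable_EFinP; exact: measurable_int iq.
  apply: (@le_integrable _ _ _ mu setT measurableT _ (fun x => M%:E * (EFin \o q) x)).
  - by apply/measurable_EFinP; exact: measurable_funM.
  - move=> x _ /=; rewrite lee_fin !normrM ler_wpM2r//.
    by rewrite (le_trans (fM x))// ler_norm.
  - exact: integrableZl.
rewrite -integralB//; [|exact: ifq..].
apply: (le_trans (le_abse_integral _ _ _)) => //.
  by apply: emeasurable_funB; [exact: measurable_int (ifq _ i1)|exact: measurable_int (ifq _ i2)].
rewrite -ge0_integralZl//; last first.
  by apply/measurable_EFinP; apply: measurableT_comp => //; exact: measurable_funB.
apply: ge0_le_integral => //.
- apply: measurableT_comp => //.
  by apply: emeasurable_funB; [exact: measurable_int (ifq _ i1)|exact: measurable_int (ifq _ i2)].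
- apply: measurable_funeM; apply/measurable_EFinP; apply: measurableT_comp => //.
  exact: measurable_funB.
- by move=> x _; rewrite -EFinB -mulrBr -EFinM lee_fin normrM ler_wpM2r.
Qed.

End density.

Section variation.
Context dp (T : measurableType dp) (R : realType).
Local Open Scope ereal_scope.

Lemma variation_dist_ge0 (m1 m2 : {finite_measure set T -> \bar R}) :
  0 <= variation_dist m1 m2.
Proof. by rewrite /variation_dist /variation_norm adde_ge0. Qed.

(** Each Jordan part has as total mass the absolute value of the difference on one Hahn set, hence
    one [e] for each part. *)
Lemma variation_dist_le (m1 m2 : {finite_measure set T -> \bar R}) e :
  (forall A, measurable A -> `|m1 A - m2 A| <= e) -> variation_dist m1 m2 <= e + e.
Proof.
move=> m12; rewrite /variation_dist /variation_norm; set nu := cadd _ _.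
have nuE A : nu A = m1 A - m2 A by [].
case: cid => P [N PN] /=; case: cid => N' PN'; rewrite [svalP _]/=.
have [[mP _] [mN _] _ _] := PN'.
rewrite /charge_variation; apply: leeD.
  rewrite jordan_posE cjordan_posE /crestr0 mem_set//= /crestr setTI.
  exact: le_trans (lee_abs _) (m12 _ mP).
rewrite jordan_negE cjordan_negE /crestr0 mem_set//= /crestr setTI.
by rewrite (le_trans (lee_abs _))// abseN m12.
Qed.

End variation.

(** * Normalizing constants and densities of the family *)

Section exponential_family.
Context {R : realType} {d : nat} (mu : {finite_measure set (borel R d) -> \bar R}).
Hypothesis mu_neq0 : mu setT != 0%E.
Implicit Types theta : 'rV[R]_d.

Lemma continuous_expR_dotv theta : continuous (fun x : 'rV[R]_d => expR (dotv theta x)).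
Proof.
by move=> x; apply: continuous_comp; [exact: continuous_dotv|exact: continuous_expR].
Qed.

Lemma integral_expR_dotv_gt0 theta : (0 < \int[mu]_x (expR (dotv theta x))%:E)%E.
Proof.
rewrite lt_neqAle integral_ge0 ?andbT; last by move=> x _; rewrite lee_fin expR_ge0.
apply/negP => /eqP I0.
have : Lambda mu theta = -oo%E by rewrite /Lambda -I0/= lexx.
by move/LambdaNy_mu0/eqP; apply/negP.
Qed.

(** Trades the extended logarithm for a real normalizing constant; its positivity is where [mu_neq0]
    enters. *)
Lemma domLambdaP theta : domLambda mu theta <->
  exists2 Z : R, 0 < Z & (\int[mu]_x (expR (dotv theta x))%:E = Z%:E)%E.
Proof.
have := integral_expR_dotv_gt0 theta; rewrite /domLambda/= /Lambda.
case: (integral _ _ _) => [z| |]//= z0.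
  rewrite lte_fin in z0; split=> [_|]; first by exists z.
  by rewrite leNgt z0/= ltry.
by split=> [//|[]].
Qed.

Lemma densityE theta (Z : R) x : 0 < Z ->
  (\int[mu]_x (expR (dotv theta x))%:E = Z%:E)%E ->
  expeR ((dotv theta x)%:E - Lambda mu theta) = (expR (dotv theta x) / Z)%:E.
Proof.
move=> Z0 IZ; rewrite /Lambda IZ/= leNgt Z0/= expRB lnK//.
Qed.

Lemma integral_expR_dotv_div theta (Z : R) : 0 < Z ->
  (\int[mu]_x (expR (dotv theta x))%:E = Z%:E)%E ->
  (\int[mu]_x (expR (dotv theta x) / Z)%:E = 1)%E.
Proof.
move=> Z0 IZ; under eq_integral do rewrite EFinM muleC.
rewrite ge0_integralZl//=; [|exact: measurable_expR_dotv|by rewrite lee_fin invr_ge0 ltW].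
by rewrite IZ -EFinM mulVf ?gt_eqF.
Qed.

Lemma integrable_density theta (Z : R) : 0 < Z ->
  (\int[mu]_x (expR (dotv theta x))%:E = Z%:E)%E ->
  mu.-integrable setT (fun x : borel R d => (expR (dotv theta x) / Z)%:E).
Proof.
move=> Z0 IZ; apply/integrableP; split.
  apply/measurable_EFinP; apply: measurable_funM => //.
  by apply: continuous_measurable_borel; exact: continuous_expR_dotv.
rewrite (eq_integral (fun x : borel R d => (expR (dotv theta x) / Z)%:E)).
  by rewrite (integral_expR_dotv_div _ _ Z0 IZ) ltry.
by move=> x _; rewrite gee0_abs// lee_fin divr_ge0 ?expR_ge0// ltW.
Qed.

Lemma integral_Q theta (Z : R) (f : borel R d -> R) : 0 < Z ->
  (\int[mu]_x (expR (dotv theta x))%:E = Z%:E)%E ->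
  measurable_fun setT f -> bounded_fun f ->
  (\int[Q mu theta]_x (f x)%:E = \int[mu]_x (f x * (expR (dotv theta x) / Z))%:E)%E.
Proof.
move=> Z0 IZ mf bf.
rewrite (@integral_density _ (borel R d) R _ mu _ (EFin \o f) (integrable_density _ _ Z0 IZ))//.
  by move=> A mA; apply: eq_integral => x _; rewrite (densityE _ _ _ Z0 IZ).
by apply: measurable_bounded_integrable => //; rewrite ltey_eq fin_num_measure.
Qed.

End exponential_family.

(** * Convergent parameters *)

Section convergent_parameters.
Context {R : realType} {d : nat} (mu : {finite_measure set (borel R d) -> \bar R}).
Hypothesis mu_neq0 : mu setT != 0%E.
Implicit Types theta : 'rV[R]_d.

Lemma cvg_dotvl (u_ : nat -> 'rV[R]_d) u x :
  u_ n @[n --> \oo] --> u -> dotv (u_ n) x @[n --> \oo] --> dotv u x.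
Proof.
move=> uu; rewrite dotvC (_ : (fun n => _) = dotv x \o u_).
  by apply: continuous_cvg => //; exact: continuous_dotv.
by apply/funext => n /=; rewrite dotvC.
Qed.

(** Equal to 1 where the sup norm is at most [k - 1] and to 0 where it is at least [k]. On its
    support the exponentials are bounded, uniformly over bounded parameters. *)
Definition cutoff (k : nat) (x : 'rV[R]_d) : R := clamp (k%:R - `|x|).

Lemma continuous_cutoff k : continuous (cutoff k).
Proof.
apply: continuous_clamp => x.
apply: (@cvgB R R^o _ (nbhs x) _ (fun=> k%:R) (fun y : 'rV[R]_d => `|y|)).
  exact: (@cst_continuous 'rV[R]_d R k%:R x).
exact: norm_continuous.
Qed.

Lemma cutoff_cvg1 x : cutoff k x @[k --> \oo] --> (1 : R).
Proof.
apply: cvg_near_cst; exists (Num.truncn (`|x| + 1)).+1 => // k /= xk.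
rewrite /cutoff clamp_eq1// lerBrDr addrC ltW//.
by rewrite (lt_le_trans (truncnS_gt _))// ler_nat.
Qed.

Lemma cvg_integral_cutoff (m : {finite_measure set (borel R d) -> \bar R}) :
  (\int[m]_x (cutoff k x)%:E)%E @[k --> \oo] --> m setT.
Proof.
rewrite -[X in _ --> m X]setIT -(integral_indic m measurableT) //.
apply: (@dominated_cvg _ (borel R d) R m setT measurableT _ _ (cst 1%E)) => //.
- move=> n; apply/measurable_EFinP; apply: continuous_measurable_borel.
  exact/continuous_cutoff.
- move=> x _; apply: cvg_EFin; first exact: nearW.
  by rewrite indicE mem_set//; exact: cutoff_cvg1.
- exact: finite_measure_integrable_cst.
- by move=> n x _; rewrite gee0_abs ?lee_fin ?clamp_ge0 ?clamp_le1.
Qed.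

Lemma cutoff_expR_le k theta (M : R) x : `|theta| <= M ->
  cutoff k x * expR (dotv theta x) <= expR (d%:R * M * k%:R).
Proof.
move=> tM; have [kx|xk] := leP k%:R `|x|.
  by rewrite /cutoff clamp_eq0 ?subr_le0// mul0r expR_ge0.
rewrite (@le_trans _ _ (expR (dotv theta x)))//.
  by rewrite ger_pMl ?expR_gt0// clamp_le1.
rewrite ler_expR (le_trans (ler_norm _))// (le_trans (dotv_le_norm _ _))//.
by apply: ler_pM => //; [rewrite ler_wpM2l|exact: ltW].
Qed.

Lemma measurable_cutoff_expR k theta :
  measurable_fun [set: borel R d] (fun x => cutoff k x * expR (dotv theta x)).
Proof.
apply: measurable_funM; apply: continuous_measurable_borel.
  exact: continuous_cutoff.
exact: continuous_expR_dotv.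
Qed.

Lemma integrable_cutoff_expR k theta :
  mu.-integrable setT (fun x : borel R d => (cutoff k x * expR (dotv theta x))%:E).
Proof.
apply: (@le_integrable _ _ _ mu setT measurableT _ (cst (expR (d%:R * `|theta| * k%:R))%:E)).
- by apply/measurable_EFinP; exact: measurable_cutoff_expR.
- move=> x _; rewrite gee0_abs ?lee_fin ?mulr_ge0 ?clamp_ge0 ?expR_ge0//.
  by rewrite (le_trans _ (ler_norm _))// cutoff_expR_le.
- exact: finite_measure_integrable_cst.
Qed.

Variables (theta_ : nat -> 'rV[R]_d) (theta : 'rV[R]_d).
Hypothesis theta_cvg : theta_ n @[n --> \oo] --> theta.

Lemma cvg_integral_cutoff_expR k :
  (\int[mu]_x (cutoff k x * expR (dotv (theta_ n) x))%:E)%E @[n --> \oo] -->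
  (\int[mu]_x (cutoff k x * expR (dotv theta x))%:E)%E.
Proof.
have [M [_ HM]] : bounded_fun theta_.
  by apply: cvg_seq_bounded; apply/cvg_ex; exists theta.
have {}HM n : `|theta_ n| <= M + 1 by apply: HM => //; rewrite ltrDl.
apply: (@dominated_cvg _ (borel R d) R mu setT measurableT _ _
    (cst (expR (d%:R * (M + 1) * k%:R))%:E)) => //.
- by move=> n; apply/measurable_EFinP; exact: measurable_cutoff_expR.
- move=> x _; apply: cvg_EFin; first exact: nearW.
  apply: (@cvgMl_tmp R _ _ _ (fun n => expR (dotv (theta_ n) x))).
  by apply: continuous_cvg; [exact: continuous_expR|exact: cvg_dotvl].
- exact: finite_measure_integrable_cst.
- move=> n x _; rewrite gee0_abs ?lee_fin ?mulr_ge0 ?clamp_ge0 ?expR_ge0//.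
  exact: cutoff_expR_le.
Qed.

Variable Z_ : nat -> R.
Hypothesis Z_gt0 : forall n, 0 < Z_ n.
Hypothesis IZ_ : forall n, (\int[mu]_x (expR (dotv (theta_ n) x))%:E = (Z_ n)%:E)%E.
Variable P : probability (borel R d) R.
Hypothesis QP : cvg_weakly (fun n => Q mu (theta_ n)) P.

(* Testing against a cutoff function of positive [P]-integral shows that the
   normalizing constants [Z_ n] converge; by Fatou's lemma the limit dominates
   the normalizing constant of [theta], and no mass escapes because [P] has
   total mass 1. *)
Lemma cvg_normalizing : exists2 Z : R, 0 < Z &
  (\int[mu]_x (expR (dotv theta x))%:E = Z%:E)%E /\ Z_ n @[n --> \oo] --> Z.
Proof.
pose N k t := fine (\int[mu]_x (cutoff k x * expR (dotv t x))%:E)%E.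
have NE k t : (\int[mu]_x (cutoff k x * expR (dotv t x))%:E = (N k t)%:E)%E.
  by rewrite fineK//; apply: integrable_fin_num => //; exact: integrable_cutoff_expR.
pose p k := fine (\int[P]_x (cutoff k x)%:E)%E.
have pE k : (\int[P]_x (cutoff k x)%:E = (p k)%:E)%E.
  rewrite fineK//; apply: integrable_fin_num => //.
  apply: continuous_bounded_integrable; [exact: continuous_cutoff|exact: bounded_clamp].
have p1 : p k @[k --> \oo] --> (1 : R).
  by apply: fine_cvg; rewrite -[1%:E](probability_setT P); exact: cvg_integral_cutoff.
have N1 k : N k (theta_ n) @[n --> \oo] --> N k theta.
  apply: fine_cvg; rewrite -NE; exact: cvg_integral_cutoff_expR.
have N2 k : N k (theta_ n) / Z_ n @[n --> \oo] --> p k.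
  have := QP _ (continuous_cutoff k) (bounded_clamp _).
  rewrite pE => /fine_cvg; apply: cvg_trans; apply: near_eq_cvg; apply: nearW => n /=.
  rewrite (integral_Q mu (theta_ n) (Z_ n))//; last 2 first.
    by apply: continuous_measurable_borel; exact: continuous_cutoff.
    exact: bounded_clamp.
  under eq_integral do rewrite mulrA EFinM muleC.
  rewrite ge0_integralZl//; last 3 first.
  - by apply/measurable_EFinP; exact: measurable_cutoff_expR.
  - by move=> x _; rewrite lee_fin mulr_ge0 ?clamp_ge0 ?expR_ge0.
  - by rewrite lee_fin invr_ge0 ltW.
  by rewrite NE -EFinM/= mulrC.
have [k pk0] : exists k, 0 < p k.
  by have [k _ /(_ k (leqnn _))] := cvgr_gt _ p1 _ ltr01; exists k.
have Zcvg : Z_ n @[n --> \oo] --> N k theta / p k.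
  have : N k (theta_ n) / (N k (theta_ n) / Z_ n) @[n --> \oo] --> N k theta / p k.
    by apply: cvgM => //; apply: cvgV => //; rewrite gt_eqF.
  apply: cvg_trans; apply: near_eq_cvg.
  (* Since [x / 0 = 0], cancelling [N k (theta_ n)] requires it to be nonzero; this holds eventually
     because the ratio tends to [p k > 0]. *)
  near=> n; have : 0 < N k (theta_ n) / Z_ n by near: n; exact: (cvgr_gt _ (N2 k) _ pk0).
  have [->|N0 _] := eqVneq (N k (theta_ n)) 0; first by rewrite mul0r ltxx.
  by rewrite invf_div mulrCA divff// mulr1.
set Z' := N k theta / p k in Zcvg.
have fatouZ : (\int[mu]_x (expR (dotv theta x))%:E <= Z'%:E)%E.
  have := @fatou _ (borel R d) R mu setT measurableT
    (fun n (x : borel R d) => (expR (dotv (theta_ n) x))%:E)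
    (fun n => measurable_expR_dotv (theta_ n)).
  have -> : limn_einf (fun n => \int[mu]_x (expR (dotv (theta_ n) x))%:E)%E = Z'%:E.
    have H : (\int[mu]_x (expR (dotv (theta_ n) x))%:E)%E @[n --> \oo] --> Z'%:E.
      rewrite (_ : (fun n => _) = EFin \o Z_); last exact/funext.
      by apply: cvg_EFin Zcvg; exact: nearW.
    by rewrite is_cvg_limn_einfE; [exact/cvg_lim|apply/cvg_ex; exists Z'%:E].
  rewrite (eq_integral (fun x : borel R d => (expR (dotv theta x))%:E)).
    by apply => n x _; rewrite lee_fin expR_ge0.
  move=> x _; have H : (expR (dotv (theta_ n) x))%:E @[n --> \oo] --> (expR (dotv theta x))%:E.
    apply: cvg_EFin; first exact: nearW.
    by apply: continuous_cvg; [exact: continuous_expR|exact: cvg_dotvl].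
  by rewrite is_cvg_limn_einfE; [exact/cvg_lim|apply/cvg_ex; eexists; exact: H].
have I0 := integral_expR_dotv_gt0 mu mu_neq0 theta.
have [Z IZ] : exists Z : R, (\int[mu]_x (expR (dotv theta x))%:E = Z%:E)%E.
  exists (fine (\int[mu]_x (expR (dotv theta x))%:E)%E); rewrite fineK//.
  by rewrite ge0_fin_numE ?(ltW I0)// (le_lt_trans fatouZ)// ltry.
rewrite IZ lte_fin in I0; rewrite IZ lee_fin in fatouZ.
have Z'0 : 0 < Z' by exact: lt_le_trans fatouZ.
exists Z => //; split => //.
suff -> : Z = Z' by [].
apply/eqP; rewrite eq_le fatouZ/= -[leLHS]mul1r -ler_pdivlMr//.
(* As [Z' > 0], weak convergence gives [p l = N l theta / Z'] for every [l], and a cutoff is at most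
   1. Letting [l] grow turns the bound into [1 <= Z / Z']. *)
have : forall k, p k <= Z / Z'.
  move=> l; have : N l (theta_ n) / Z_ n @[n --> \oo] --> N l theta / Z'.
    by apply: cvgM => //; apply: cvgV => //; rewrite gt_eqF.
  move=> /(cvg_unique _ (N2 l)) -> //.
  rewrite ler_pM2r ?invr_gt0// -lee_fin -NE -IZ; apply: ge0_le_integral => //.
  - by move=> x _; rewrite lee_fin mulr_ge0 ?clamp_ge0 ?expR_ge0.
  - by apply/measurable_EFinP; exact: measurable_cutoff_expR.
  - exact: measurable_expR_dotv.
  - by move=> x _; rewrite lee_fin ger_pMl ?expR_gt0// clamp_le1.
move=> pZ; rewrite -(cvg_lim _ p1)//; apply: limr_le.
  by apply/cvg_ex; exists 1.
exact: nearW.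
Unshelve. all: end_near. Qed.

Lemma cvg_density_L1 (Z : R) : 0 < Z ->
  (\int[mu]_x (expR (dotv theta x))%:E = Z%:E)%E -> Z_ n @[n --> \oo] --> Z ->
  (\int[mu]_x `|expR (dotv (theta_ n) x) / Z_ n - expR (dotv theta x) / Z|%:E)%E
    @[n --> \oo] --> 0%E.
Proof.
move=> Z0 IZ Zcvg; apply: (@scheffe _ (borel R d)).
- move=> n; apply: measurable_funM => //.
  by apply: continuous_measurable_borel; exact: continuous_expR_dotv.
- apply: measurable_funM => //.
  by apply: continuous_measurable_borel; exact: continuous_expR_dotv.
- by move=> n x; rewrite divr_ge0 ?expR_ge0// ltW.
- by move=> x; rewrite divr_ge0 ?expR_ge0// ltW.
- by move=> n; exact: integral_expR_dotv_div.
- exact: integral_expR_dotv_div.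
- move=> x; apply: cvgM; last by apply: cvgV => //; rewrite gt_eqF.
  by apply: continuous_cvg; [exact: continuous_expR|exact: cvg_dotvl].
Qed.

(** Convergence of the densities in L1 controls all bounded measurable functions at once: continuous
    ones identify [P], and indicators bound the variation distance uniformly over sets. *)
Lemma limit_exponential_family : [/\ domLambda mu theta,
  forall A : set (borel R d), measurable A -> P A = Q mu theta A &
  variation_dist (Q mu (theta_ n)) P @[n --> \oo] --> 0%E].
Proof.
have [Z Z0 [IZ Zcvg]] := cvg_normalizing.
have L1 := cvg_density_L1 Z Z0 IZ Zcvg.
pose D n := (\int[mu]_x `|expR (dotv (theta_ n) x) / Z_ n - expR (dotv theta x) / Z|%:E)%E.
have QD (f : borel R d -> R) (M : R) n : measurable_fun setT f -> (forall x, `|f x| <= M) ->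
    (`|\int[Q mu (theta_ n)]_x (f x)%:E - \int[Q mu theta]_x (f x)%:E| <= M%:E * D n)%E.
  move=> mf fM.
  have bf : bounded_fun f.
    exists M; split; first exact: num_real.
    by move=> K MK x _; exact: (le_trans (fM x) (ltW MK)).
  (* A plain rewrite does not terminate here: it tests the two integrals, which
     differ only in their parameter, for conversion. *)
  apply: (eq_ind_r (fun t => `|t|%E <= _)%E _ (congr2 (fun s t => s - t)%E
    (integral_Q mu _ _ f (Z_gt0 n) (IZ_ n) mf bf) (integral_Q mu _ _ f Z0 IZ mf bf))).
  apply: abse_integral_sub_le => //; exact: integrable_density.
have PQ : forall A : set (borel R d), measurable A -> P A = Q mu theta A.
  apply: eq_measure_continuous => f cf bf.
  apply: (cvg_unique (@ereal_hausdorff R) (QP _ cf bf)).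
  have mf := continuous_measurable_borel cf.
  have [M [_ HM]] := bf.
  have fM x : `|f x| <= M + 1 by apply: HM => //; rewrite ltrDl.
  have If : (\int[Q mu theta]_x (f x)%:E)%E \is a fin_num.
    by apply: integrable_fin_num => //; exact: continuous_bounded_integrable.
  apply/sube_cvg0 => //; apply/cvg_abse0P.
  apply: (@squeeze_cvge _ _ _ _ (cst 0%E) _ (fun n => (M + 1)%:E * D n)%E).
  - by apply: nearW => n; rewrite abse_ge0/=; exact: QD.
  - exact: cvg_cst.
  - by rewrite -(mule0 (M + 1)%:E); exact: cvgeZl.
split => //; first by apply/(domLambdaP mu mu_neq0); exists Z.
apply: (@squeeze_cvge _ _ _ _ (cst 0%E) _ (fun n => D n + D n)%E).
- apply: nearW => n; rewrite variation_dist_ge0/=; apply: variation_dist_le => A mA.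
  have I t : (\int[Q mu t]_x (\1_A x)%:E = Q mu t A)%E by rewrite integral_indic// setIT.
  have QA : (`|Q mu (theta_ n) A - Q mu theta A| <= D n)%E.
    apply: (eq_ind _ (fun t => `|t|%E <= _)%E _ _ (congr2 (fun s t => s - t)%E (I _) (I _))).
    rewrite -[D n]mul1e; apply: QD; first exact: measurable_indic.
    by move=> x; rewrite indicE; case: (_ \in _); rewrite ?normr1 ?normr0.
  exact: (eq_ind_r (fun t => `|_ - t| <= _)%E QA (PQ A mA)).
- exact: cvg_cst.
- by rewrite -[X in _ --> X](adde0 0%E); apply: cvgeD.
Qed.

End convergent_parameters.

(** * Exposed faces *)

Section hyperplanes.
Context {R : realType} {d : nat}.
Implicit Types (u : 'rV[R]_d) (k : R) (A B : set 'rV[R]_d).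

Lemma closed_dotv_le u k : closed [set x | dotv u x <= k].
Proof. by apply: (closed_comp _ (@closed_le _ k)) => x _; exact: continuous_dotv. Qed.

Lemma closed_dotv_eq u k : closed [set x | dotv u x = k].
Proof. by apply: (closed_comp _ (@closed_eq _ k)) => x _; exact: continuous_dotv. Qed.

Lemma open_dotv_gt u k : open [set x | k < dotv u x].
Proof. by apply: (open_comp _ (@open_gt _ k)) => x _; exact: continuous_dotv. Qed.

Lemma open_dotv_lt u k : open [set x | dotv u x < k].
Proof. by apply: (open_comp _ (@open_lt _ k)) => x _; exact: continuous_dotv. Qed.

Lemma convex_dotv_le u k : convex_set [set x | dotv u x <= k].
Proof.
apply/convex_setP => x y t /= xk yk t0 t1; rewrite dotvDr !dotvZr.
have -> : k = t * k + (1 - t) * k by rewrite -mulrDl addrC subrK mul1r.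
by rewrite lerD// ler_wpM2l// subr_ge0.
Qed.

Lemma convex_dotv_eq u k : convex_set [set x | dotv u x = k].
Proof.
apply/convex_setP => x y t /= xk yk t0 t1; rewrite dotvDr !dotvZr xk yk.
by rewrite -mulrDl addrC subrK mul1r.
Qed.

Lemma convex_setI A B : convex_set A -> convex_set B -> convex_set (A `&` B).
Proof.
move=> /convex_setP cA /convex_setP cB; apply/convex_setP => x y t [Ax Bx] [Ay By] t0 t1.
by split; [exact: cA|exact: cB].
Qed.

(** The gaps [k - x] and [k - y] are nonnegative and a sum of them with positive weights vanishes.
    This is the face property of a contact set. *)
Lemma convex_comb_eq_max (x y k t : R) : x <= k -> y <= k -> 0 < t -> t < 1 ->
  t * x + (1 - t) * y = k -> x = k /\ y = k.
Proof.
move=> xk yk t0 t1 E.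
have t10 : 0 < 1 - t by rewrite subr_gt0.
have : t * (k - x) + (1 - t) * (k - y) = 0.
  by rewrite !mulrBr addrACA -mulrDl [t + _]addrC subrK mul1r -opprD E subrr.
move=> /eqP; rewrite paddr_eq0 ?mulr_ge0 ?subr_ge0 ?(ltW t0) ?(ltW t1)//.
rewrite !mulf_eq0 (gt_eqF t0) (gt_eqF t10)/= !subr_eq0.
by move=> /andP[/eqP <- /eqP <-].
Qed.

(** If the contact set were all of [C], then [u] would be constant on [C], hence orthogonal to
    [lin C] and to itself, against [enorm u = 1]. *)
Lemma exposes_hyperplane (C : set 'rV[R]_d) u k : convex_set C -> enorm u = 1 ->
  lin C u -> (forall x, C x -> dotv u x <= k) ->
  C `&` [set x | dotv u x = k] !=set0 ->
  exposes u C (C `&` [set x | dotv u x = k]).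
Proof.
move=> cC u1 Lu Ck [a [Ca ak]].
split => //; last first.
  exists a; split => //.
    by move=> x /Ck; rewrite dotvBr ak subr_le0.
  apply/seteqP; split=> x [Cx] /=; rewrite dotvBr ak; first by move=> ->; rewrite subrr.
  by move/eqP; rewrite subr_eq0 => /eqP.
split.
  split => //; first by exists a.
  - exact: convex_setI (convex_dotv_eq u k).
  - move=> x y t Cx Cy t0 t1 [_ /=]; rewrite dotvDr !dotvZr.
    by move=> /(convex_comb_eq_max _ _ _ _ (Ck _ Cx) (Ck _ Cy) t0 t1)[xk yk]; split.
move=> E.
have uk x : C x -> dotv u x = k by rewrite -E => -[].
have := dotv_lin_eq0 C u u k uk (ex_intro _ a Ca) Lu.
by move: u1; rewrite /enorm => /[swap] ->; rewrite sqrtr0 => /esym/eqP; rewrite oner_eq0.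
Qed.

Lemma exposes_closed (C G : set 'rV[R]_d) u : closed C -> exposes u C G -> closed G.
Proof.
move=> cC [_ _ _ [a [_ _ ->]]]; apply: closedI => //.
rewrite (_ : mkset _ = [set x | dotv u x = dotv u a]); first exact: closed_dotv_eq.
apply/seteqP; split=> x /=; rewrite dotvBr; last by move=> ->; rewrite subrr.
by move/eqP; rewrite subr_eq0 => /eqP.
Qed.

End hyperplanes.

(** * Injectivity of the parametrization and mass on proper faces *)

Section exponential_family.
Context {R : realType} {d : nat} (mu : {finite_measure set (borel R d) -> \bar R}).
Hypothesis mu_neq0 : mu setT != 0%E.
Implicit Types theta : 'rV[R]_d.

(** Equal densities put [mu], and hence [cs mu], on a level set of [dotv (theta1 - theta2)]; this
    difference lies in [lin (cs mu)], so it is orthogonal to itself. *)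
Lemma Q_inj theta1 theta2 : Theta mu theta1 -> Theta mu theta2 ->
  (forall A : set (borel R d), measurable A -> Q mu theta1 A = Q mu theta2 A) ->
  theta1 = theta2.
Proof.
move=> [/(domLambdaP mu mu_neq0)[Z1 Z10 I1] L1] [/(domLambdaP mu mu_neq0)[Z2 Z20 I2] L2] Q12.
have i1 := integrable_density mu _ _ Z10 I1.
have i2 := integrable_density mu _ _ Z20 I2.
pose C := [set x | dotv (theta1 - theta2) x = ln Z1 - ln Z2].
have QE theta Z A : 0 < Z -> (\int[mu]_x (expR (dotv theta x))%:E = Z%:E)%E ->
    Q mu theta A = (\int[mu]_(x in A) (expR (dotv theta x) / Z)%:E)%E.
  by move=> Z0 IZ; apply: eq_integral => x _; exact: densityE.
have mC : mu (~` C) = 0%E.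
  apply/(negligibleP mu).
    by apply: open_measurable_borel; apply: closed_openC; exact: closed_dotv_eq.
  have : ae_eq mu setT (fun x : borel R d => (expR (dotv theta1 x) / Z1)%:E)
      (fun x : borel R d => (expR (dotv theta2 x) / Z2)%:E).
    apply: integral_ae_eq => //; first exact: measurable_int i2.
    by move=> A _ mA; have := Q12 A mA; rewrite (QE _ _ _ Z10 I1) (QE _ _ _ Z20 I2).
  rewrite /ae_eq /almost_everywhere; apply: negligibleS => x; apply: contra_not => /(_ I)[] E.
  have {E} : ln (expR (dotv theta1 x) / Z1) = ln (expR (dotv theta2 x) / Z2) by rewrite E.
  rewrite !ln_div ?posrE ?expR_gt0// !expRK => E.
  by rewrite /C /= dotvBl -(subrK (ln Z1) (dotv theta1 x)) E addrAC [_ - ln Z2]addrC addrK addrC.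
have csC := cs_sub mu C (closed_dotv_eq _ _) (convex_dotv_eq _ _) mC.
have cs0 := cs_neq0 mu mu_neq0.
have [_ LD LZ] := subspace_lin _ cs0.
have L12 : lin (cs mu) (theta1 - theta2).
  by apply: LD => //; rewrite -scaleN1r; exact: LZ.
apply/eqP; rewrite -subr_eq0; apply/eqP; apply: dotvv_eq0.
exact: (dotv_lin_eq0 _ _ _ _ csC cs0 L12).
Qed.

(** The density is positive, so [Q mu theta] and [mu] have the same null sets. If [G] had
    probability 1, it would be a closed convex set of full [mu]-measure and would contain
    [cs mu]. *)
Lemma Q_exposed_neq1 theta u G : domLambda mu theta -> exposes u (cs mu) G ->
  Q mu theta G <> 1%E.
Proof.
move=> /[dup] dom /(domLambdaP mu mu_neq0)[Z Z0 IZ] uG QG.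
have cG := exposes_closed _ _ _ (closed_cs mu) uG.
have mG := closed_measurable_borel _ cG.
have [[[_ vG Gcs _] Gneq] _ _ _] := uG.
apply: Gneq; apply/seteqP; split => //; apply: cs_sub => //.
have QC : Q mu theta (~` (G : set (borel R d))) = 0%E.
  have : Q mu theta setT = (Q mu theta (~` (G : set (borel R d))) + Q mu theta G)%E.
    rewrite -[in LHS](setvU G); apply: measureU => //; [exact: measurableC|exact: setICl].
  by rewrite Q_setT// QG => /(congr1 (fun y => y - 1)%E); rewrite addeK// subee.
apply/(negligibleP mu); first exact: measurableC.
have mq := measurable_density mu theta.
have : (\int[mu]_(x in ~` (G : set (borel R d)))
    `|expeR ((dotv theta x)%:E - Lambda mu theta)| = 0)%E.
  by rewrite -QC; apply: eq_integral => x _; rewrite gee0_abs ?expeR_ge0.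
move/(ae_eq_integral_abs mu (measurableC mG) (measurable_funTS mq)).
rewrite /ae_eq /almost_everywhere; apply: negligibleS => x /= Gx /(_ Gx)/eqP.
by rewrite (densityE _ _ _ _ Z0 IZ) eqe gt_eqF// divr_gt0 ?expR_gt0.
Qed.

End exponential_family.

(** * Divergent parameters *)

Section divergent_parameters.
Context {R : realType} {d : nat} (mu : {finite_measure set (borel R d) -> \bar R}).
Hypothesis mu_neq0 : mu setT != 0%E.
Variable theta_ : nat -> 'rV[R]_d.
Hypothesis theta_in : forall n, Theta mu (theta_ n).
Variable P : probability (borel R d) R.
Hypothesis QP : cvg_weakly (fun n => Q mu (theta_ n)) P.

(** Absolute continuity with respect to [mu] may be lost in a weak limit, but [mu]-null cozero sets
    remain null. *)
Lemma limit_null (f : 'rV[R]_d -> R) : continuous f ->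
  mu [set x | 0 < f x] = 0%E -> P [set x | 0 < f x] = 0%E.
Proof.
move=> cf muf; apply: (cvg_weakly_null _ _ _ QP cf).
have mU : measurable ([set x | 0 < f x] : set (borel R d)).
  apply: open_measurable_borel.
  by apply: (open_comp _ (@open_gt _ 0)) => x _; exact: cf.
have mc : measurable_fun [set: borel R d] (fun x => clamp (f x)).
  by apply: continuous_measurable_borel; exact: continuous_clamp.
apply: cvg_near_cst; apply: nearW => n.
have [/(domLambdaP mu mu_neq0)[Z Z0 IZ] _] := theta_in n.
rewrite (integral_Q mu _ _ (fun x => clamp (f x)) Z0 IZ mc (bounded_clamp f)).
rewrite -(@integral0 _ (borel R d) R mu setT); apply: ae_eq_integral => //.
  apply/measurable_EFinP; apply: measurable_funM => //.
  by apply: measurable_funM => //; apply: continuous_measurable_borel; exact: continuous_expR_dotv.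
rewrite /ae_eq /almost_everywhere; apply: (@negligibleS _ (borel R d) R mu [set x | 0 < f x]).
  move=> x /=; apply: contra_notP => /negP; rewrite -leNgt => fx _.
  by rewrite clamp_eq0// mul0r.
exact: (negligibleP mu mU).2 muf.
Qed.

Lemma limit_csC : P (~` cs mu) = 0%E.
Proof.
have oU : open (~` cs mu) by apply: closed_openC; exact: closed_cs.
have [] := @countable_ball_cover R d (~` cs mu) [set A | A `<=` ~` cs mu].
- exact: sub0set.
- move=> x Ux; have : nbhs x (~` cs mu) by exact: open_nbhs_nbhs.
  by move=> /nbhs_ballP[e e0 eU]; exists e => // A /subset_trans; exact.
move=> F [FE FU UF].
have mF n : measurable (F n : set (borel R d)).
  apply: open_measurable_borel; have [->|[c [e ->]]] := FE n; first exact: open0.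
  exact: ball_open.
apply: (null_bigcup P _ F) => //; first exact: open_measurable_borel.
move=> n; have F0 : mu (F n) = 0%E.
  apply/eqP; rewrite eq_le measure_ge0 andbT -(cs_measureC mu).
  by apply: le_measure; rewrite ?inE//; [exact: open_measurable_borel|exact: FU].
have [E|[c [e E]]] := FE n; first by rewrite E measure0.
have [f cf fE] := cozero_ball c e.
by move: F0; rewrite E fE => /(limit_null _ cf).
Qed.

Variable tau : 'rV[R]_d.
Hypothesis theta_oo : enorm (theta_ n) @[n --> \oo] --> +oo.
Hypothesis theta_tau : (enorm (theta_ n))^-1 *: theta_ n @[n --> \oo] --> tau.

Lemma continuous_halfspace_bounded (a K : R) :
  continuous (fun x => Num.min (a - dotv tau x) (K - `|x|)).
Proof.
move=> x; apply: (@continuous_min _ _ (fun x => a - dotv tau x) (fun x => K - `|x|)).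
  apply: (@cvgB R R^o _ (nbhs x) _ (fun=> a) (dotv tau)).
    exact: (@cst_continuous 'rV[R]_d R a x).
  exact: continuous_dotv.
apply: (@cvgB R R^o _ (nbhs x) _ (fun=> K) (fun y : 'rV[R]_d => `|y|)).
  exact: (@cst_continuous 'rV[R]_d R K x).
exact: norm_continuous.
Qed.

(* If [mu] charges [dotv tau x > b], the mass that [Q mu (theta_ n)] gives to a
   bounded part of [dotv tau x < a] is at most a constant times
   [expR (- ((b - a) / 2 * enorm (theta_ n)))]. *)
Lemma limit_halfspace_bounded (a b K : R) : a < b -> mu [set x | b < dotv tau x] != 0%E ->
  P [set x | 0 < Num.min (a - dotv tau x) (K - `|x|)] = 0%E.
Proof.
move=> ab mub; pose f x := Num.min (a - dotv tau x) (K - `|x|).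
have cf : continuous f by exact: continuous_halfspace_bounded.
apply: (cvg_weakly_null _ _ _ QP cf).
pose B k := [set x | b < dotv tau x] `&` [set x | `|x| < k%:R].
have mB k : measurable (B k : set (borel R d)).
  apply: open_measurable_borel; apply: openI; first exact: open_dotv_gt.
  by apply: (open_comp _ (@open_lt _ k%:R)) => x _; exact: norm_continuous.
have [k muBk] : exists k, mu (B k) != 0%E.
  apply: contrapT => /forallNP H; move/eqP : mub; apply.
  apply: (null_bigcup mu _ B) => //.
  - by apply: open_measurable_borel; exact: open_dotv_gt.
  - by move=> k; apply: contrapT => /eqP; exact: H.
  - by move=> x /= xb; exists (Num.truncn `|x|).+1 => //; split => //=; exact: truncnS_gt.
pose beta := fine (mu (B k)); pose m := fine (mu setT).
have betaE : mu (B k) = beta%:E by rewrite fineK// fin_num_measure.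
have mE : mu setT = m%:E by rewrite fineK// fin_num_measure.
have beta0 : 0 < beta by rewrite -lte_fin -betaE lt_neqAle eq_sym muBk measure_ge0.
have m0 : 0 <= m by rewrite -lee_fin -mE measure_ge0.
(* The exponent is at most [r n * (a + delta)] on the bounded part of the lower half-space and at
   least [r n * (b - delta)] on [B k]; with a quarter of the gap as [delta], these differ by
   [c * r n]. The radius [K0] covers both regions. *)
pose delta := (b - a) / 4; pose c := (b - a) / 2; pose K0 := `|K| + k%:R.
have delta0 : 0 < delta by rewrite divr_gt0 ?subr_gt0.
have c0 : 0 < c by rewrite divr_gt0 ?subr_gt0.
have K00 : 0 <= K0 by rewrite addr_ge0.
pose r n := enorm (theta_ n).
have bound n : 0 < r n -> d%:R * `|(r n)^-1 *: theta_ n - tau| * K0 <= delta ->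
    (\int[Q mu (theta_ n)]_x (clamp (f x))%:E <= (m / beta * expR (- (c * r n)))%:E)%E.
  move=> r0 tK.
  have lin_le x : `|x| <= K0 -> `|dotv (theta_ n) x - r n * dotv tau x| <= r n * delta.
    move=> xK.
    have -> : dotv (theta_ n) x - r n * dotv tau x =
        r n * dotv ((r n)^-1 *: theta_ n - tau) x.
      by rewrite dotvBl dotvZl mulrBr mulVKf ?gt_eqF.
    rewrite normrM gtr0_norm// ler_wpM2l ?(ltW r0)// (le_trans _ tK)//.
    by rewrite (le_trans (dotv_le_norm _ _))// ler_wpM2l// mulr_ge0.
  have [/(domLambdaP mu mu_neq0)[Z Z0 IZ] _] := theta_in n.
  have Zge : beta * expR (r n * (b - delta)) <= Z.
    rewrite -lee_fin -IZ mulrC EFinM -betaE -(@integral_cst _ (borel R d) R mu (B k))//.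
    apply: (@le_trans _ _ (\int[mu]_(x in B k) (expR (dotv (theta_ n) x))%:E)%E).
      apply: ge0_le_integral => //.
      - by move=> x _; rewrite lee_fin expR_ge0.
      - by apply: measurable_funTS; exact: measurable_expR_dotv.
      - move=> x [/= xb xk]; rewrite lee_fin ler_expR.
        have /lin_le : `|x| <= K0 by rewrite (le_trans (ltW xk))// lerDr.
        rewrite ler_norml lerBrDl => /andP[+ _]; apply: le_trans.
        by rewrite mulrBr lerB// ler_wpM2l ?ltW.
    apply: ge0_subset_integral => //; first exact: measurable_expR_dotv.
  have mc : measurable_fun [set: borel R d] (fun x => clamp (f x)).
    by apply: continuous_measurable_borel; exact: continuous_clamp.
  have -> := integral_Q mu _ _ (fun x => clamp (f x)) Z0 IZ mc (bounded_clamp f).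
  apply: (@le_trans _ _ (\int[mu]_(x in [set: borel R d]) (expR (r n * (a + delta)) / Z)%:E)%E).
    apply: ge0_le_integral => //.
    - by move=> x _; rewrite lee_fin mulr_ge0 ?clamp_ge0// divr_ge0 ?expR_ge0// ltW.
    - apply/measurable_EFinP; apply: measurable_funM => //; apply: measurable_funM => //.
      by apply: continuous_measurable_borel; exact: continuous_expR_dotv.
    - move=> x _; rewrite lee_fin mulrA ler_pM2r ?invr_gt0//.
      have [fx|] := leP (f x) 0; first by rewrite clamp_eq0// mul0r expR_ge0.
      rewrite lt_min !subr_gt0 => /andP[xa xK].
      rewrite (@le_trans _ _ (expR (dotv (theta_ n) x)))//.
        by rewrite ger_pMl ?expR_gt0// clamp_le1.
      rewrite ler_expR.
      have /lin_le : `|x| <= K0 by rewrite (le_trans (ltW xK))// (le_trans (ler_norm K))// lerDl.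
      rewrite ler_norml lerBlDl => /andP[_]; move/le_trans; apply.
      by rewrite mulrDr lerD2r ler_wpM2l ?ltW.
  have -> : (\int[mu]_(x in [set: borel R d]) (expR (r n * (a + delta)) / Z)%:E =
      (expR (r n * (a + delta)) / Z)%:E * m%:E)%E by rewrite -mE; exact: integral_cst.
  rewrite -EFinM lee_fin.
  have -> : - (c * r n) = r n * (a + delta) - r n * (b - delta).
    by rewrite /c /delta; field.
  rewrite expRB mulrC -mulrA ler_wpM2l// mulrCA ler_wpM2l ?expR_ge0//.
  by rewrite -invfM lef_pV2 ?posrE ?mulr_gt0 ?expR_gt0// mulrC.
apply: (@squeeze_cvge _ _ _ _ (cst 0%E) _ (fun n => (m / beta * expR (- (c * r n)))%:E)).
- have r0 := (cvgryPgt _).1 theta_oo 0.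
  (* The summand 1 keeps the denominator positive when [d%:R * K0] is 0. *)
  have e0 : 0 < delta / (d%:R * K0 + 1) by rewrite divr_gt0// ltr_wpDl// mulr_ge0.
  near=> n; rewrite integral_ge0/=; last by move=> x _; rewrite lee_fin clamp_ge0.
  apply: bound; first by near: n; exact: r0.
  have : `|tau - (r n)^-1 *: theta_ n| < delta / (d%:R * K0 + 1).
    by near: n; move/cvgrPdist_lt : theta_tau; exact.
  rewrite ltr_pdivlMr ?ltr_wpDl ?mulr_ge0// distrC => /ltW; apply: le_trans.
  by rewrite mulrAC mulrC ler_wpM2l// lerDl.
- exact: cvg_cst.
- apply: cvg_EFin; first exact: nearW.
  rewrite -[X in _ --> X](mulr0 (m / beta)); apply: cvgMl_tmp.
  apply: (cvg_comp (fun n => c * r n) (fun x => expR (- x)) _ (@cvgr_expR R)).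
  apply/cvgryPge => A; near=> n; rewrite mulrC -ler_pdivrMr//.
  by near: n; exact: (cvgryPge _).1 theta_oo (A / c).
Unshelve. all: end_near. Qed.

Lemma limit_halfspace (a b : R) : a < b -> mu [set x | b < dotv tau x] != 0%E ->
  P [set x | dotv tau x < a] = 0%E.
Proof.
move=> ab mub.
apply: (null_bigcup P _ (fun k => [set x | 0 < Num.min (a - dotv tau x) (k%:R - `|x|)])).
- by apply: open_measurable_borel; exact: open_dotv_lt.
- move=> k; apply: open_measurable_borel.
  by apply: (open_comp _ (@open_gt _ 0)) => x _; exact: continuous_halfspace_bounded.
- by move=> k; exact: limit_halfspace_bounded mub.
- move=> x /= xa; exists (Num.truncn `|x|).+1 => //=.
  by rewrite lt_min !subr_gt0 xa truncnS_gt.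
Qed.

Lemma limit_exposed_face : exists G, exposes tau (cs mu) G /\ P G = 1%E.
Proof.
have cs0 := cs_neq0 mu mu_neq0.
have [_ LD LZ] := subspace_lin _ cs0.
have tau1 : enorm tau = 1.
  have H : enorm ((enorm (theta_ n))^-1 *: theta_ n) @[n --> \oo] --> enorm tau.
    by apply: continuous_cvg theta_tau; exact: continuous_enorm.
  apply: (cvg_unique _ H) => //; apply: cvg_near_cst.
  have := theta_oo => /cvgryPgt/(_ 0); apply: filterS => n n0.
  by rewrite enormZ ger0_norm ?invr_ge0 ?enorm_ge0// mulVf ?gt_eqF.
have Ltau : lin (cs mu) tau.
  apply: (closed_cvg (lin (cs mu)) _ _ tau theta_tau).
    by apply: closed_subspace; exact: subspace_lin.
  by apply: nearW => n; apply: LZ; have [] := theta_in n.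
pose S := [set b | mu [set x | b < dotv tau x] != 0%E].
have mgt k :
    measurable ([set x | k < dotv tau x] : set (borel R d)).
  by apply: open_measurable_borel; exact: open_dotv_gt.
have mlt k : measurable ([set x | dotv tau x < k] : set (borel R d)).
  by apply: open_measurable_borel; exact: open_dotv_lt.
have S0 : S !=set0.
  apply: contrapT => /forallNP SN.
  suff mu0 : mu setT = 0%E by move: mu_neq0; rewrite mu0 eqxx.
  apply: (null_bigcup mu setT (fun n => [set x | - n%:R < dotv tau x])) => //.
    by move=> n; apply: contrapT => /eqP; exact: SN.
  move=> x _; exists (Num.truncn `|dotv tau x|).+1 => //=.
  by rewrite ltrNl (le_lt_trans _ (truncnS_gt _))// -normrN ler_norm.
have Slow b a : S b -> a < b -> P [set x | dotv tau x < a] = 0%E.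
  by move=> Sb ab; exact: limit_halfspace ab Sb.
(* Were [S] unbounded, every half-space [dotv tau x < n%:R] would be [P]-null, and so would the
   whole space. *)
have Sub : has_ubound S.
  apply: contrapT => Sub.
  have : P setT = 0%E.
    apply: (null_bigcup P setT (fun n => [set x | dotv tau x < n%:R])) => //.
      move=> n; have [b Sb nb] : exists2 b, S b & n%:R < b.
        apply: contrapT => H; apply: Sub; exists n%:R => b Sb.
        by rewrite leNgt; apply/negP => nb; apply: H; exists b.
      exact: Slow Sb nb.
    move=> x _; exists (Num.truncn `|dotv tau x|).+1 => //=.
    by rewrite (le_lt_trans _ (truncnS_gt _))// ler_norm.
  by rewrite probability_setT => /eqP; rewrite onee_eq0.
pose s := sup S.
(* [limit_halfspace] needs a strict gap below an element of [S], so the level [s] is approached from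
   below. *)
have Ps : P [set x | dotv tau x < s] = 0%E.
  apply: (null_bigcup P _ (fun n => [set x | dotv tau x < s - n.+1%:R^-1])) => //.
    move=> n; have [|b Sb sb] := @sup_adherent _ S n.+1%:R^-1 _ (conj S0 Sub).
      by rewrite invr_gt0.
    exact: Slow Sb sb.
  move=> x /= xs; have [n ns] := ltr_add_invr xs; exists n => //=.
  by rewrite ltrBrDr.
have csle : cs mu `<=` [set x | dotv tau x <= s].
  apply: cs_sub; [exact: closed_dotv_le|exact: convex_dotv_le|].
  apply: (null_bigcup mu _ (fun n => [set x | s + n.+1%:R^-1 < dotv tau x])).
  - by apply: open_measurable_borel; apply: closed_openC; exact: closed_dotv_le.
  - by move=> n; exact: mgt.
  - move=> n; apply: contrapT => /eqP Sn.
    have := ub_le_sup Sub (Sn : S (s + n.+1%:R^-1)).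
    by rewrite leNgt ltrDl invr_gt0 ltr0n.
  - move=> x /= /negP; rewrite -ltNge => sx; have [n ns] := ltr_add_invr sx.
    by exists n.
pose G := cs mu `&` [set x | dotv tau x = s].
have cG : closed G by apply: closedI; [exact: closed_cs|exact: closed_dotv_eq].
have mG : measurable (G : set (borel R d)) by exact: closed_measurable_borel.
have PGC : P (~` G) = 0%E.
  (* Index 0 takes the points outside [cs mu], index 1 those of [cs mu] strictly below level [s]. *)
  apply: (null_bigcup P _ (fun n => if n is 0%N then ~` cs mu else [set x | dotv tau x < s])).
  - exact: measurableC.
  - case=> [|n] //; apply: open_measurable_borel; apply: closed_openC; exact: closed_cs.
  - by case=> [|n]//; exact: limit_csC.
  - move=> x Gx; have [xcs|xcs] := pselect (cs mu x); last by exists 0%N.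
    exists 1%N => //=; rewrite lt_neqAle (csle _ xcs) andbT; apply/eqP => xs.
    by apply: Gx; split.
have PG : P G = 1%E.
  by rewrite -[G]setCK (probability_setC P (measurableC mG)) PGC sube0.
exists G; split => //; apply: exposes_hyperplane => //; first exact: convex_cs.
(* The supremum [s] need not be attained on an unbounded convex support; the contact set is nonempty
   because [P] gives it mass 1. *)
apply/set0P/negP => /eqP G0; move: PG; rewrite /G G0 measure0 => /eqP.
by rewrite eq_sym onee_eq0.
Qed.

End divergent_parameters.

Lemma cvg_weakly_subseq {R : realType} {d : nat}
    (P_ : nat -> {finite_measure set (borel R d) -> \bar R})
    (P : {finite_measure set (borel R d) -> \bar R}) (s : nat -> nat) :
  increasing_seq s -> cvg_weakly P_ P -> cvg_weakly (P_ \o s) P.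
Proof.
move=> /increasing_seq_oo sincr PP f cf bf.
exact: (cvg_comp _ _ sincr (PP f cf bf)).
Qed.

(** * Limits along convergent and along unbounded parameter sequences *)

Section exponential_family.
Context {R : realType} {d : nat} (mu : {finite_measure set (borel R d) -> \bar R}).
Hypothesis mu_neq0 : mu setT != 0%E.
Variables (theta_ : nat -> 'rV[R]_d) (P : probability (borel R d) R).
Hypothesis theta_in : forall n, Theta mu (theta_ n).
Hypothesis QP : cvg_weakly (fun n => Q mu (theta_ n)) P.

Lemma limit_bounded theta : theta_ n @[n --> \oo] --> theta -> [/\ Theta mu theta,
  forall A : set (borel R d), measurable A -> P A = Q mu theta A &
  variation_dist (Q mu (theta_ n)) P @[n --> \oo] --> 0%E].
Proof.
move=> thetac.
have /choice[Z_ HZ] n : exists Z : R, 0 < Z /\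
    (\int[mu]_x (expR (dotv (theta_ n) x))%:E = Z%:E)%E.
  by have [/(domLambdaP mu mu_neq0)[Z ? ?] _] := theta_in n; exists Z.
have [dom PQ var] := limit_exponential_family mu mu_neq0 theta_ theta thetac Z_
  (fun n => (HZ n).1) (fun n => (HZ n).2) P QP.
split => //; split => //; apply: (closed_cvg (lin (cs mu)) _ _ theta thetac).
  by apply: closed_subspace; apply: subspace_lin; exact: cs_neq0.
by apply: nearW => n; have [] := theta_in n.
Qed.

Lemma limit_unbounded : enorm (theta_ n) @[n --> \oo] --> +oo ->
  exists tau G, exposes tau (cs mu) G /\ P G = 1%E.
Proof.
move=> theta_oo.
have [H|[s [tau [sincr stau]]]] :=
    bolzano_weierstrass_rV (fun n => (enorm (theta_ n))^-1 *: theta_ n).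
  (* Normalized parameters eventually have norm 1, so their norms cannot diverge. *)
  exfalso; near \oo => n.
  have : 1 < enorm ((enorm (theta_ n))^-1 *: theta_ n).
    by near: n; exact: (cvgryPgt _).1 H 1.
  rewrite enormZ ger0_norm ?invr_ge0 ?enorm_ge0// mulVf ?ltxx// gt_eqF//.
  by near: n; exact: (cvgryPgt _).1 theta_oo 0.
exists tau; exact: (limit_exposed_face mu mu_neq0 (theta_ \o s) (fun n => theta_in (s n)) P
  (cvg_weakly_subseq _ _ s sincr QP) tau
  (cvg_comp _ _ (increasing_seq_oo _ sincr) theta_oo) stau).
Unshelve. all: end_near. Qed.

End exponential_family.

Theorem theorem1 (R : realType) (d : nat)
    (mu : {finite_measure set (borel R d) -> \bar R})
    (mu_neq0 : mu setT != 0%E)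
    (theta_ : nat -> 'rV[R]_d)
    (theta_in : forall n, Theta mu (theta_ n))
    (P : probability (borel R d) R)
    (QP : cvg_weakly (fun n => Q mu (theta_ n)) P) :
  (exists theta : 'rV[R]_d,
    [/\ Theta mu theta,
        theta_ n @[n --> \oo] --> theta,
        forall A : set (borel R d), measurable A -> P A = Q mu theta A &
        variation_dist (Q mu (theta_ n)) P @[n --> \oo] --> 0%E])
  \/
  [/\ enorm (theta_ n) @[n --> \oo] --> +oo,
      exists G : set 'rV[R]_d,
        [/\ proper_face (cs mu) G, exposed_face (cs mu) G & P G = 1%E] &
      forall (s : nat -> nat) (tau : 'rV[R]_d), increasing_seq s ->
        (enorm (theta_ (s k)))^-1 *: theta_ (s k) @[k --> \oo] --> tau ->
        exists G : set 'rV[R]_d, exposes tau (cs mu) G /\ P G = 1%E].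
Proof.
have sub_in (s : nat -> nat) n : Theta mu ((theta_ \o s) n) by exact: theta_in.
have [theta_oo|[s [theta [sincr stheta]]]] := bolzano_weierstrass_rV theta_.
  right; split => //.
    have [tau [G [tauG PG]]] := limit_unbounded mu mu_neq0 _ P theta_in QP theta_oo.
    by exists G; split => //; [case: tauG|exists tau].
  move=> s tau sincr stau.
  exact: (limit_exposed_face mu mu_neq0 (theta_ \o s) (sub_in s) P
    (cvg_weakly_subseq _ _ s sincr QP) tau
    (cvg_comp _ _ (increasing_seq_oo _ sincr) theta_oo) stau).
left.
have [thetaT PQ _] := limit_bounded mu mu_neq0 (theta_ \o s) P (sub_in s)
  (cvg_weakly_subseq _ _ s sincr QP) theta stheta.
suff theta_cvg : theta_ n @[n --> \oo] --> theta.
  have [_ _ var] := limit_bounded mu mu_neq0 theta_ P theta_in QP theta theta_cvg.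
  by exists theta; split.
(* A subsequence staying at distance [e] from [theta] still has weak limit [P]. If it diverges, [P]
   lives on a proper face, impossible for [Q mu theta]; otherwise a further subsequence has a limit
   representing [P], which is [theta] by injectivity. *)
apply: contrapT => /not_cvg_subseq[e [t [e0 tincr te]]].
have Qt := cvg_weakly_subseq _ _ t tincr QP.
have [too|[r [theta' [rincr rtheta']]]] := bolzano_weierstrass_rV (theta_ \o t).
  have [tau [G [tauG PG]]] := limit_unbounded mu mu_neq0 _ P (sub_in t) Qt too.
  have mG : measurable (G : set (borel R d)).
    by apply: closed_measurable_borel; exact: exposes_closed (closed_cs mu) tauG.
  by apply: (Q_exposed_neq1 mu mu_neq0 theta _ _ thetaT.1 tauG); rewrite -PQ.
have [thetaT' PQ' _] := limit_bounded mu mu_neq0 (theta_ \o t \o r) P (sub_in (t \o r))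
  (cvg_weakly_subseq _ _ r rincr Qt) theta' rtheta'.
have E : theta = theta'.
  exact: (Q_inj mu mu_neq0 _ _ thetaT thetaT'
    (fun A mA => etrans (esym (PQ A mA)) (PQ' A mA))).
move/cvgrPdist_lt : rtheta' => /(_ _ e0)[N _ /(_ N (leqnn _))] /=.
by rewrite -E ltNge te.
Qed.
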